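(* Let $V\neq\{0\}$ be a Banach $\mathbb O$-bimodule and $T\in\mathscr B_{\mathcal{RO}}(V)$ power-associative. Then every $s\in\mathbb O$ with $|s|>\|T\|$ belongs to $\rho^*(T)$ (indeed to $\rho^*_J(T)$ for any $J$ with $s\in\mathbb C_J$), and for every $J\in\mathbb S$ the set $\sigma^*_J(T):=\mathbb C_J\setminus\rho_J^*(T)$ is a nonempty compact subset of $\mathbb C_J$.
   Context: $\mathbb O$ is the real octonion algebra with basis $e_0=1,\dots,e_7$, norm $|x|$; $\mathbb S=\{J\in\mathbb O:J^2=-1\}$, $\mathbb C_J=\mathbb R+\mathbb RJ$. An $\mathbb O$-bimodule is a real vector space $M$ with real-bilinear left and right multiplications by $\mathbb O$ (with $1x=x1=x$) whose associators $[p,q,x]=(pq)x-p(qx)$, $[p,x,q]=(px)q-p(xq)$, $[x,p,q]=(xp)q-x(pq)$ satisfy $[p,q,x]=[q,x,p]=[x,p,q]=-[q,p,x]$. Its real part is $\operatorname{Re}M=\{m: pm=mp,\ [p,q,m]=0\ \forall p,q\}$; $\operatorname{Re}x$ is the $e_0$-component in the unique decomposition $x=\sum e_ix_i$, $x_i\in\operatorname{Re}M$. A Banach $\mathbb O$-bimodule is one with a complete norm with $\|px\|=\|xp\|=|p|\|x\|$. $\mathscr B_{\mathbb R}(V)$: bounded real-linear operators with ordinary composition/powers; invertible means in $\mathscr B_{\mathbb R}(V)$; $R_sv=vs$. $\mathscr B_{\mathcal{RO}}(V)$: bounded real-linear $f$ with $\operatorname{Re}(f(x)p-f(xp))=0$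 for all $p,x$. $T$ is power-associative if $T^n\in\mathscr B_{\mathcal{RO}}(V)$ for all $n$. $S$ is $\mathbb C_J$-extendable power associative if $S^n(v\lambda)=S^n(v)\lambda$ for all $n\ge1,v\in\operatorname{Re}V,\lambda\in\mathbb C_J$. $\rho_J^*(T)=\{s\in\mathbb C_J: R_s-T$ invertible and $(R_s-T)^{-1}$ $\mathbb C_J$-extendable power associative$\}$, $\rho^*(T)=\bigcup_J\rho^*_J(T)$, pull-back spectrum $\sigma^*(T)=\mathbb O\setminus\rho^*(T)$. *)

(* Defs.v *)
From HB Require Import structures.
From mathcomp Require Import all_boot all_order all_algebra.
From mathcomp Require Import all_classical all_reals all_analysis.
From Stdlib Require Import ClassicalEpsilon.
Set Implicit Arguments. Unset Strict Implicit. Unset Printing Implicit Defensive.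
Import Order.TTheory GRing.Theory Num.Theory.
Import numFieldNormedType.Exports.
Local Open Scope classical_set_scope.
Local Open Scope ring_scope.

(** * The real octonion algebra O, as R^8 = 'rV[R]_8 with basis e_0 = 1, ..., e_7. *)
Definition Oct (R : realType) := 'rV[R]_8.

(** Cayley-Dickson multiplication table: e_i e_j = sign * e_(|t|-1) where t = oct_tab i j. *)
Definition oct_tab : seq (seq int) :=
  [:: [:: 1; 2; 3; 4; 5; 6; 7; 8];
      [:: 2; -1; 4; -3; 6; -5; -8; 7];
      [:: 3; -4; -1; 2; 7; 8; -5; -6];
      [:: 4; 3; -2; -1; 8; -7; 6; -5];
      [:: 5; -6; -7; -8; -1; 2; 3; 4];
      [:: 6; 5; -8; 7; -2; -1; -4; 3];
      [:: 7; 8; 5; -6; -3; 4; -1; -2];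
      [:: 8; -7; 6; 5; -4; -3; 2; -1]]%Z.

Definition oct_entry (i j : 'I_8) : int := nth 0%Z (nth [::] oct_tab i) j.

Section Octonions.
Variable R : realType.

Definition oe (i : 'I_8) : Oct R := \row_(k < 8) (k == i)%:R.

Definition omul (x y : Oct R) : Oct R :=
  \sum_(i < 8) \sum_(j < 8)
     ((x ord0 i * y ord0 j) * (sgz (oct_entry i j))%:~R) *: oe (inord `|oct_entry i j|.-1).

Definition onorm (x : Oct R) : R := Num.sqrt (\sum_(i < 8) x ord0 i ^+ 2).

Definition oone : Oct R := oe ord0.

Definition oS : set (Oct R) := [set J | omul J J = - oone].

Definition CJ (J : Oct R) : set (Oct R) :=
  [set s | exists a b : R, s = a *: oone + b *: J].

End Octonions.
Arguments oS : clear implicits.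
Arguments oone : clear implicits.

Section Bimodule.
Variables (R : realType) (V : completeNormedModType R).
Variables (lm : Oct R -> V -> V) (rm : V -> Oct R -> V).

Definition assoc1 (p q : Oct R) (x : V) : V := lm (omul p q) x - lm p (lm q x).
Definition assoc2 (p : Oct R) (x : V) (q : Oct R) : V := rm (lm p x) q - lm p (rm x q).
Definition assoc3 (x : V) (p q : Oct R) : V := rm (rm x p) q - rm x (omul p q).

Record BanachOBimodule : Prop := {
  lm_linl : forall (a : R) p q x, lm (a *: p + q) x = a *: lm p x + lm q x;
  lm_linr : forall (a : R) p x y, lm p (a *: x + y) = a *: lm p x + lm p y;
  rm_linl : forall (a : R) x y p, rm (a *: x + y) p = a *: rm x p + rm y p;
  rm_linr : forall (a : R) x p q, rm x (a *: p + q) = a *: rm x p + rm x q;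
  lm_one : forall x, lm (oone R) x = x;
  rm_one : forall x, rm x (oone R) = x;
  assoc_12 : forall p q x, assoc1 p q x = assoc2 q x p;
  assoc_23 : forall p q x, assoc2 q x p = assoc3 x p q;
  assoc_31 : forall p q x, assoc3 x p q = - assoc1 q p x;
  norm_lm : forall p x, `|lm p x| = onorm p * `|x|;
  norm_rm : forall p x, `|rm x p| = onorm p * `|x|
}.

Definition ReM (m : V) : Prop :=
  (forall p, lm p m = rm m p) /\ (forall p q, assoc1 p q m = 0).

Definition ReDecomp (x : V) (xs : 'I_8 -> V) : Prop :=
  (forall i, ReM (xs i)) /\ x = \sum_(i < 8) lm (oe R i) (xs i).

(** Re x = the e_0-component x_0 of the (unique) decomposition *)
Definition ReV (x : V) : V :=
  epsilon (inhabits 0) (fun x0 => exists xs, ReDecomp x xs /\ xs ord0 = x0).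

Definition bounded_lin (f : V -> V) : Prop :=
  (forall (a : R) x y, f (a *: x + y) = a *: f x + f y) /\
  (exists C : R, forall x, `|f x| <= C * `|x|).

Definition opnorm (f : V -> V) : R := sup [set `|f x| | x in [set x : V | `|x| <= 1]].

Definition B_RO (f : V -> V) : Prop :=
  bounded_lin f /\ forall p x, ReV (rm (f x) p - f (rm x p)) = 0.

Definition power_assoc (T : V -> V) : Prop := forall n : nat, B_RO (iter n T).

Definition inverse_in_BR (A S : V -> V) : Prop :=
  bounded_lin S /\ cancel A S /\ cancel S A.

Definition CJ_ext_pa (J : Oct R) (S : V -> V) : Prop :=
  forall (n : nat) (v : V) (l : Oct R), (1 <= n)%N -> ReM v -> CJ J l ->
    iter n S (rm v l) = rm (iter n S v) l.

Definition RsT (s : Oct R) (T : V -> V) : V -> V := fun v => rm v s - T v.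

Definition rhoJ (T : V -> V) (J : Oct R) : set (Oct R) :=
  [set s | CJ J s /\ bounded_lin (RsT s T) /\
           exists S, inverse_in_BR (RsT s T) S /\ CJ_ext_pa J S].

Definition rho (T : V -> V) : set (Oct R) :=
  [set s | exists J, oS R J /\ rhoJ T J s].

Definition sigmaJ (T : V -> V) (J : Oct R) : set (Oct R) := CJ J `\` rhoJ T J.

End Bimodule.

(* Main.v *)
Require Import Defs.
From HB Require Import structures.
From mathcomp Require Import all_boot all_order all_algebra.
From mathcomp Require Import all_classical all_reals all_analysis.
From mathcomp Require Import ring lra.
From Stdlib Require Import ClassicalEpsilon.
Set Implicit Arguments. Unset Strict Implicit. Unset Printing Implicit Defensive.
Import Order.TTheory GRing.Theory Num.Theory.
Import numFieldNormedType.Exports.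
Local Open Scope classical_set_scope.
Local Open Scope ring_scope.

(** The left multiplications by [e_1, ..., e_7] generate a representation of the
    Clifford algebra [Cl_7], and the associator identities express the right
    multiplications through them and force [L_1 ... L_7 = -1].  Hence
    [x - sum_lines L_i L_j L_k x], divided by 8, is the projection onto [Re V], and
    [V] is the direct sum of the [e_i Re V].  It follows that a power-associative [T]
    satisfies [T^n (v p) = T^n (v) p] for real [v].

    With [j v = v J], the set [W] of all [w] such that every power of an operator
    [Q] commutes with [j] on [w] is closed and stable under [Q] and [j].  Neumann's
    lemma on [W], with [Q = T] for large [s] and with [Q = (R_t - T)^-1] for [s]
    near [t], makes [rho_J] contain the exterior of a disc and makes it open.

    If [rho_J] were the whole plane, then [F (s) = (R_s - T)^-1 v], for [v] real,
    would have a second order complex Taylor expansion at every point, so that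
    the mean of [F] over [s + h], [s - h], [s + J h], [s - J h] would be
    [F (s) + O (h^3)]; adding [eps |s|^2] to [|F|] then rules out interior maxima,
    and [F], vanishing at infinity, would be zero. *)

(** * Octonions *)

(** Natural number indices let [vm_compute] decide statements about the whole table. *)
Definition tab_entry (i j : nat) : int := nth 0 (nth [::] oct_tab i) j.
Definition tab_sgn (i j : nat) : int := sgz (tab_entry i j).
Definition tab_idx (i j : nat) : nat := `|tab_entry i j|.-1.

Section OctonionBasis.
Variable R : realType.
Implicit Types x y : Oct R.

Lemma oeE (i k : 'I_8) : oe R i ord0 k = (k == i)%:R.
Proof. by rewrite mxE. Qed.

Lemma omul_oe (i j : 'I_8) :
  omul (oe R i) (oe R j) = (tab_sgn i j)%:~R *: oe R (inord (tab_idx i j)).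
Proof.
rewrite /omul (bigD1 i) //= (bigD1 j) //= !oeE !eqxx !mul1r.
rewrite [X in _ + X + _]big1 ?[X in _ + X]big1 ?addr0 // => [k ki|k kj].
  by rewrite big1 // => l _; rewrite oeE (negbTE ki) !mul0r scale0r.
by rewrite !oeE (negbTE kj) mulr0 mul0r scale0r.
Qed.

Lemma omul_sum x y : omul x y =
  \sum_(i < 8) \sum_(j < 8) (x ord0 i * y ord0 j) *: omul (oe R i) (oe R j).
Proof.
by apply: eq_bigr => i _; apply: eq_bigr => j _; rewrite omul_oe scalerA.
Qed.

Lemma oct_basis_sum x : x = \sum_(i < 8) x ord0 i *: oe R i.
Proof.
apply/rowP => k; rewrite summxE (bigD1 k) //= mxE oeE eqxx mulr1.
rewrite big1 ?addr0 // => i ik; rewrite mxE oeE eq_sym (negbTE ik).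
exact: mulr0.
Qed.

Lemma tab_idx_lt (i j : nat) : (i < 8)%N -> (j < 8)%N -> (tab_idx i j < 8)%N.
Proof.
move=> i8 j8.
suff /allP/(_ i) : all (fun a => all (fun b => (tab_idx a b < 8)%N) (iota 0 8))
    (iota 0 8).
  by rewrite mem_iota => /(_ i8)/allP/(_ j); rewrite mem_iota; apply.
by vm_compute.
Qed.

(** The polarized form of x^2 = 2 Re(x) x - |x|^2 on basis vectors, coordinate by coordinate,
    decided by enumeration. *)
Lemma tab_anticomm (i j k : 'I_8) :
  tab_sgn i j * (k == tab_idx i j :> nat)%:R + tab_sgn j i * (k == tab_idx j i :> nat)%:R
  = (2 * (i == 0%N :> nat)%:R) * (k == j)%:R + (2 * (j == 0%N :> nat)%:R) * (k == i)%:R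
    - (2 * (i == j)%:R) * (k == 0%N :> nat)%:R :> int.
Proof.
have: all (fun i => all (fun j => all (fun k =>
   tab_sgn i j * (k == tab_idx i j)%:R + tab_sgn j i * (k == tab_idx j i)%:R ==
   (2 * (i == 0)%:R) * (k == j)%:R + (2 * (j == 0)%:R) * (k == i)%:R
    - (2 * (i == j)%:R) * (k == 0)%:R) (iota 0 8)) (iota 0 8)) (iota 0 8).
  by vm_compute.
move=> /allP/(_ i); rewrite mem_iota => /(_ (ltn_ord i)).
move=> /allP/(_ j); rewrite mem_iota => /(_ (ltn_ord j)).
by move=> /allP/(_ k); rewrite mem_iota => /(_ (ltn_ord k))/eqP.
Qed.

(** Only the symmetric part of the table contributes to a square: twice the double sum is the sum
    plus its transpose, to which [tab_anticomm] applies. *)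
Lemma oct_sqr x :
  omul x x = (2 * x ord0 ord0) *: x - (\sum_(i < 8) x ord0 i ^+ 2) *: oone R.
Proof.
apply/rowP => k.
pose c (i j : 'I_8) : R := (tab_sgn i j * (k == tab_idx i j :> nat)%:R)%:~R.
have E : omul x x ord0 k = \sum_(i < 8) \sum_(j < 8) x ord0 i * x ord0 j * c i j.
  rewrite /omul summxE; apply: eq_bigr => i _; rewrite summxE.
  apply: eq_bigr => j _; rewrite mxE oeE /c rmorphM /= -mulrA; congr (_ * (_ * _)).
  by rewrite -val_eqE /= inordK ?tab_idx_lt // rmorph_nat.
have E2 : omul x x ord0 k = \sum_(i < 8) \sum_(j < 8) x ord0 i * x ord0 j * c j i.
  rewrite E exchange_big; apply: eq_bigr => i _; apply: eq_bigr => j _.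
  by rewrite (mulrC (x _ j)).
apply: (@mulfI _ 2); first by rewrite pnatr_eq0.
rewrite mulr_natl mulr2n {1}E E2 -big_split /=.
transitivity (\sum_(i < 8) ((2 * (i == ord0)%:R) * x ord0 i * x ord0 k
   + (2 * x ord0 ord0) * x ord0 i * (k == i)%:R
   - 2 * x ord0 i ^+ 2 * (k == ord0)%:R)).
  apply: eq_bigr => i _; rewrite -big_split /=.
  transitivity (\sum_(j < 8) (2 * (i == ord0)%:R * x ord0 i * (x ord0 j * (j == k)%:R)
     + 2 * x ord0 i * (k == i)%:R * (x ord0 j * (j == ord0)%:R)
     - 2 * x ord0 i * (k == ord0)%:R * (x ord0 j * (j == i)%:R))).
    apply: eq_bigr => j _; rewrite -mulrDr /c -rmorphD /= tab_anticomm.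
    rewrite !(rmorphB, rmorphD, rmorphM, rmorph_nat, rmorph1) /=.
    rewrite -!val_eqE /= [_ == j :> nat]eq_sym [j == i :> nat]eq_sym; ring.
  have S (l : 'I_8) : \sum_(j < 8) x ord0 j * (j == l)%:R = x ord0 l.
    rewrite (bigD1 l) //= eqxx mulr1 big1 ?addr0 // => j /negbTE ->.
    exact: mulr0.
  rewrite sumrB big_split /= -!mulr_sumr !S; ring.
rewrite sumrB big_split /= -!mulr_suml -!mulr_sumr.
have S : \sum_(i < 8) 2 * (i == ord0)%:R * x ord0 i = 2 * x ord0 ord0.
  rewrite (bigD1 ord0) //= big1 => [|i /negbTE ->]; last by rewrite mulr0 mul0r.
  by rewrite addr0 mulr1.
have S' : \sum_(i < 8) 2 * x ord0 ord0 * x ord0 i * (k == i)%:R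
          = 2 * x ord0 ord0 * x ord0 k.
  rewrite (bigD1 k) //= eqxx mulr1 big1 ?addr0 // => j.
  by rewrite eq_sym => /negbTE ->; rewrite mulr0.
rewrite S S' !mxE; ring.
Qed.

Lemma oS_coord J : oS R J -> J ord0 ord0 = 0 /\ \sum_(i < 8) J ord0 i ^+ 2 = 1.
Proof.
rewrite /oS /= oct_sqr => JJ.
have e k : (2 * J ord0 ord0) * J ord0 k - (\sum_(i < 8) J ord0 i ^+ 2) * (k == ord0)%:R
           = - (k == ord0)%:R.
  by move/rowP: JJ => /(_ k); rewrite !mxE.
have J0 : J ord0 ord0 = 0.
  apply/eqP/negP => /negP J0.
  have Jk k : k != ord0 -> J ord0 k = 0.
    move=> /negbTE k0; have := e k; rewrite k0 mulr0 subr0 oppr0 => /eqP.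
    by rewrite !mulf_eq0 pnatr_eq0 (negbTE J0) /= => /eqP.
  (* If the real coordinate is nonzero, the others vanish, and the e_0-coordinate of the equation
     says that its square is -1. *)
  have := e ord0; rewrite (bigD1 ord0) //= big1 => [|i /Jk ->]; last by rewrite expr0n.
  rewrite ?eqxx => h; have : 0 <= J ord0 ord0 ^+ 2 by exact: sqr_ge0.
  move: h; rewrite !addr0 !mulr1 expr2; nra.
split=> //; have := e ord0; rewrite J0 eqxx !mulr1 mulr0 sub0r => /eqP.
by rewrite eqr_opp => /eqP.
Qed.

Lemma onorm_CJ J a b : oS R J ->
  onorm (a *: oone R + b *: J) = Num.sqrt (a ^+ 2 + b ^+ 2).
Proof.
move=> /oS_coord[J0 J1]; rewrite /onorm; congr Num.sqrt.
transitivity (\sum_(i < 8) (a ^+ 2 * (i == ord0)%:R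
    + b ^+ 2 * J ord0 i ^+ 2 + 2 * a * b * ((i == ord0)%:R * J ord0 i))).
  by apply: eq_bigr => i _; rewrite !mxE; case: eqP => _ /=; ring.
rewrite !big_split /= -!mulr_sumr J1.
rewrite (bigD1 ord0) //= big1 => [|i /negbTE ->//].
rewrite [X in _ + _ * X]big1 => [|i _]; last first.
  by case: eqP => [->|_]; rewrite ?J0 ?mulr0 ?mul0r.
by rewrite ?eqxx /=; ring.
Qed.

Lemma mem_some_CJ (s : Oct R) : exists J, oS R J /\ CJ J s.
Proof.
pose y := s - s ord0 ord0 *: oone R.
have y0 : y ord0 ord0 = 0 by rewrite !mxE eqxx mulr1 subrr.
pose N := \sum_(i < 8) y ord0 i ^+ 2.
have N0 : 0 <= N by apply: sumr_ge0 => i _; exact: sqr_ge0.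
have [NE|NE] := eqVneq N 0.
  have yE : y = 0.
    apply/rowP => i; rewrite [RHS]mxE; apply/eqP; rewrite -sqrf_eq0.
    move/eqP: NE; rewrite psumr_eq0 => [/allP|k _]; last exact: sqr_ge0.
    by apply; rewrite mem_index_enum.
  (* Here s is real and lies in every C_J, so e_1 serves as J. *)
  pose e := oe R (lift ord0 ord0); exists e; split.
    rewrite /oS /= oct_sqr !oeE /= mulr0 scale0r sub0r (bigD1 (lift ord0 ord0)) //=.
    rewrite big1 => [|i /negbTE ie]; first by rewrite oeE eqxx expr1n addr0 scale1r.
    by rewrite oeE ie expr0n.
  exists (s ord0 ord0), 0; rewrite scale0r addr0.
  by apply/eqP; rewrite -subr_eq0 -/y yE.
have r0 : Num.sqrt N != 0 by rewrite sqrtr_eq0 -ltNge lt_neqAle eq_sym NE.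
exists ((Num.sqrt N)^-1 *: y); split.
  rewrite /oS /= oct_sqr !mxE eqxx mulr1 subrr !mulr0 scale0r sub0r; congr (- _).
  rewrite -[RHS]scale1r; congr (_ *: _).
  transitivity ((Num.sqrt N)^-1 ^+ 2 * N).
    by rewrite /N mulr_sumr; apply: eq_bigr => i _; rewrite mxE exprMn.
  by rewrite -{2}(sqr_sqrtr N0) -exprMn mulVf ?expr1n.
exists (s ord0 ord0), (Num.sqrt N); rewrite scalerA divff // scale1r /y.
by rewrite addrC subrK.
Qed.

End OctonionBasis.

(** * The multiplication algebra of a bimodule *)

(* A letter [i < 8] stands for left multiplication by [e_i], a letter [8 + i]
   for right multiplication by [e_i]; the leftmost letter acts last. *)
Definition ncpoly := seq (int * seq nat).

Definition scalep (c : int) (p : ncpoly) : ncpoly := [seq (c * t.1, t.2) | t <- p].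
Definition mulp (p q : ncpoly) : ncpoly :=
  flatten [seq [seq (a.1 * b.1, a.2 ++ b.2) | b <- q] | a <- p].
Definition subp (p q : ncpoly) : ncpoly := p ++ scalep (-1) q.

(* Normal words list the left multiplications first, in increasing order. *)
Fixpoint insL (i : nat) (w : seq nat) : int * seq nat :=
  if w is j :: w' then
    if [|| (8 <= j)%N, (i < j)%N, j == 0, i == 0 | (8 <= i)%N] then (1, i :: w)
    else if i == j then (-1, w')
    else let t := insL i w' in (- t.1, j :: t.2)
  else (1, [:: i]).

(** Pushes R_i to the right by R_i L_j = L_j R_i + L_(e_i e_j) - L_i L_j, the correction being the
    associator, which vanishes for i = j. Letters 0 and right multiplications stop the process. *)
Fixpoint insR (i : nat) (w : seq nat) : ncpoly :=
  if w is j :: w' then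
    if [|| (8 <= j)%N, j == 0, i == 0 | (8 <= i)%N] then [:: (1, (8 + i)%N :: w)]
    else [seq (t.1 * (insL j t.2).1, (insL j t.2).2) | t <- insR i w'] ++
      if i == j then [::] else
        [:: (tab_sgn i j * (insL (tab_idx i j) w').1, (insL (tab_idx i j) w').2);
            (- ((insL j w').1 * (insL i (insL j w').2).1), (insL i (insL j w').2).2)]
  else [:: (1, [:: (8 + i)%N])].

Definition ins (g : nat) (w : seq nat) : ncpoly :=
  if (g < 8)%N then [:: insL g w] else insR (g - 8) w.

Fixpoint addm (c : int) (w : seq nat) (p : ncpoly) : ncpoly :=
  if p is (d, u) :: p' then
    if u == w then if c + d == 0 then p' else (c + d, w) :: p'
    else (d, u) :: addm c w p'
  else [:: (c, w)].

Definition collect (p : ncpoly) : ncpoly := foldr (fun t => addm t.1 t.2) [::] p.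

Definition insp (g : nat) (p : ncpoly) : ncpoly :=
  collect (flatten [seq scalep t.1 (ins g t.2) | t <- p]).

Definition normw (w : seq nat) : ncpoly := foldr insp [:: (1, [::])] w.

Definition normp (p : ncpoly) : ncpoly :=
  collect (flatten [seq scalep t.1 (normw t.2) | t <- p]).

Section MultiplicationAlgebra.
Variables (R : realType) (V : completeNormedModType R).
Variables (lm : Oct R -> V -> V) (rm : V -> Oct R -> V).
Hypothesis HV : BanachOBimodule lm rm.

Definition letter (g : nat) (v : V) : V :=
  if (g < 8)%N then lm (oe R (inord g)) v else rm v (oe R (inord (g - 8))).

Definition evalw (w : seq nat) (v : V) : V := foldr letter v w.

Definition evalp (p : ncpoly) (v : V) : V := \sum_(t <- p) t.1%:~R *: evalw t.2 v.

Lemma evalw_cat w u v : evalw (w ++ u) v = evalw w (evalw u v).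
Proof. exact: foldr_cat. Qed.

Lemma lm0l x : lm 0 x = 0.
Proof.
have := lm_linl HV 1 0 0 x; rewrite !scale1r addr0.
by move=> /(congr1 (fun z => z - lm 0 x)); rewrite subrr addrK.
Qed.

Lemma lmZl a p x : lm (a *: p) x = a *: lm p x.
Proof. by rewrite -[a *: p]addr0 (lm_linl HV) lm0l addr0. Qed.

Lemma lmDl p q x : lm (p + q) x = lm p x + lm q x.
Proof. by rewrite -[p]scale1r (lm_linl HV) !scale1r. Qed.

Lemma rm0r x : rm x 0 = 0.
Proof.
have := rm_linr HV 1 x 0 0; rewrite !scale1r addr0.
by move=> /(congr1 (fun z => z - rm x 0)); rewrite subrr addrK.
Qed.

Lemma rmZr a x p : rm x (a *: p) = a *: rm x p.
Proof. by rewrite -[a *: p]addr0 (rm_linr HV) rm0r addr0. Qed.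

Lemma rmDr x p q : rm x (p + q) = rm x p + rm x q.
Proof. by rewrite -[p]scale1r (rm_linr HV) !scale1r. Qed.

Lemma letter_lin g a x y : letter g (a *: x + y) = a *: letter g x + letter g y.
Proof. by rewrite /letter; case: ifP => _; [exact: lm_linr HV _ _ _ _|exact: rm_linl HV _ _ _ _]. Qed.

Lemma evalw_lin w a x y : evalw w (a *: x + y) = a *: evalw w x + evalw w y.
Proof. by elim: w => //= g w ->; rewrite letter_lin. Qed.

Lemma evalw0 w : evalw w 0 = 0.
Proof.
have := evalw_lin w 1 0 0; rewrite !scale1r addr0.
by move=> /(congr1 (fun z => z - evalw w 0)); rewrite subrr addrK.
Qed.

Lemma evalp_lin p a x y : evalp p (a *: x + y) = a *: evalp p x + evalp p y.
Proof.
rewrite /evalp scaler_sumr -big_split /=; apply: eq_bigr => t _.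
by rewrite evalw_lin scalerDr !scalerA mulrC.
Qed.

Lemma evalp0 p : evalp p 0 = 0.
Proof. by rewrite /evalp big1 // => t _; rewrite evalw0 scaler0. Qed.

Lemma evalpZ p a x : evalp p (a *: x) = a *: evalp p x.
Proof. by rewrite -[a *: x]addr0 evalp_lin evalp0 addr0. Qed.

Lemma evalp_nil v : evalp [::] v = 0. Proof. exact: big_nil. Qed.

Lemma evalp_cons t p v : evalp (t :: p) v = t.1%:~R *: evalw t.2 v + evalp p v.
Proof. exact: big_cons. Qed.

Lemma evalp_cat p q v : evalp (p ++ q) v = evalp p v + evalp q v.
Proof. exact: big_cat. Qed.

Lemma evalp_flatten ps v : evalp (flatten ps) v = \sum_(p <- ps) evalp p v.
Proof.
by elim: ps => [|p ps IH] /=; rewrite ?big_nil ?big_cons ?evalp_nil ?evalp_cat ?IH.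
Qed.

Lemma evalp_scale c p v : evalp (scalep c p) v = c%:~R *: evalp p v.
Proof.
by rewrite /evalp big_map scaler_sumr; apply: eq_bigr => t _; rewrite scalerA intrM.
Qed.

Lemma evalp_sub p q v : evalp (subp p q) v = evalp p v - evalp q v.
Proof. by rewrite evalp_cat evalp_scale rmorphN1 scaleN1r. Qed.

Lemma evalw_evalp w p v :
  evalw w (evalp p v) = \sum_(t <- p) t.1%:~R *: evalw (w ++ t.2) v.
Proof.
elim: p => [|t p IH]; first by rewrite evalp_nil evalw0 big_nil.
by rewrite evalp_cons evalw_lin IH big_cons evalw_cat.
Qed.

Lemma evalp_mul p q v : evalp (mulp p q) v = evalp p (evalp q v).
Proof.
elim: p => [|t p IH]; first by rewrite !evalp_nil.
rewrite evalp_cons /mulp /= evalp_cat -/(mulp p q) IH evalw_evalp scaler_sumr.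
congr (_ + _); rewrite /evalp big_map; apply: eq_bigr => u _ /=.
by rewrite scalerA intrM.
Qed.

Lemma letterL (i : nat) v : (i < 8)%N -> letter i v = lm (oe R (inord i)) v.
Proof. by rewrite /letter => ->. Qed.

Lemma letterR (i : nat) v : letter (8 + i)%N v = rm v (oe R (inord i)).
Proof. by rewrite /letter ltnNge leq_addr addKn. Qed.

Lemma oe0E : oe R (inord 0) = oone R.
Proof. by congr oe; apply/val_inj; rewrite /= inordK. Qed.

Lemma omul_oen (i j : nat) : (i < 8)%N -> (j < 8)%N ->
  omul (oe R (inord i)) (oe R (inord j)) =
  (tab_sgn i j)%:~R *: oe R (inord (tab_idx i j)).
Proof. by move=> i8 j8; rewrite omul_oe !inordK. Qed.

(** The cyclic and skew symmetries make an associator with a repeated entry equal to its own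
    negative. *)
Lemma assoc1_diag p x : assoc1 lm p p x = 0.
Proof.
have h : assoc1 lm p p x = - assoc1 lm p p x.
  by rewrite {1}(assoc_12 HV) (assoc_23 HV) (assoc_31 HV).
have /eqP : 2%:R *: assoc1 lm p p x = 0 by rewrite scaler_nat mulr2n {1}h addNr.
by rewrite scaler_eq0 pnatr_eq0 => /eqP.
Qed.

Lemma tab_diag (i : nat) : (0 < i < 8)%N -> tab_sgn i i = -1 /\ tab_idx i i = 0%N.
Proof. by case: i => [|[|[|[|[|[|[|[|i]]]]]]]]. Qed.

Lemma tab_swap (i j : nat) : (0 < i < 8)%N -> (0 < j < 8)%N -> i != j ->
  tab_sgn j i = - tab_sgn i j /\ tab_idx j i = tab_idx i j.
Proof.
by case: i => [|[|[|[|[|[|[|[|i]]]]]]]] //; case: j => [|[|[|[|[|[|[|[|j]]]]]]]].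
Qed.

Lemma LL_diag (i : nat) v : (0 < i < 8)%N -> letter i (letter i v) = - v.
Proof.
move=> i8; have [s0 k0] := tab_diag i8; case/andP: (i8) => _ i8'.
have := assoc1_diag (oe R (inord i)) v; rewrite /assoc1 omul_oen // s0 k0 oe0E.
rewrite lmZl (lm_one HV) rmorphN1 scaleN1r !letterL // => /eqP.
by rewrite subr_eq0 => /eqP.
Qed.

Lemma assoc1_basis (i j : nat) v : (i < 8)%N -> (j < 8)%N ->
  assoc1 lm (oe R (inord i)) (oe R (inord j)) v =
  (tab_sgn i j)%:~R *: letter (tab_idx i j) v - letter i (letter j v).
Proof.
by move=> i8 j8; rewrite /assoc1 omul_oen // lmZl !letterL // tab_idx_lt.
Qed.

(** The associator and the product e_i e_j are both skew in i and j, hence so is L_i L_j. With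
    [LL_diag] these are the Clifford relations. *)
Lemma LL_swap (i j : nat) v : (0 < i < 8)%N -> (0 < j < 8)%N -> i != j ->
  letter i (letter j v) = - letter j (letter i v).
Proof.
move=> i8 j8 ij; have [s k] := tab_swap i8 j8 ij.
case/andP: i8 => _ i8; case/andP: j8 => _ j8.
set p := oe R (inord i); set q := oe R (inord j).
have : assoc1 lm p q v = - assoc1 lm q p v.
  by rewrite (assoc_12 HV) (assoc_23 HV) (assoc_31 HV).
rewrite /p /q !assoc1_basis // s k rmorphN scaleNr opprB opprK [RHS]addrC.
by move=> /addrI <-; rewrite opprK.
Qed.

Lemma RL_swap (i j : nat) v : (0 < i < 8)%N -> (0 < j < 8)%N ->
  letter (8 + i)%N (letter j v) = letter j (letter (8 + i)%N v) +
   (if i == j then 0 else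
     (tab_sgn i j)%:~R *: letter (tab_idx i j) v - letter i (letter j v)).
Proof.
move=> /andP[_ i8] /andP[_ j8].
have := assoc_12 HV (oe R (inord i)) (oe R (inord j)) v.
rewrite assoc1_basis // /assoc2 -(letterL _ j8) -!letterR -(letterL _ j8) => h.
have -> : letter (8 + i)%N (letter j v) = letter j (letter (8 + i)%N v) +
     ((tab_sgn i j)%:~R *: letter (tab_idx i j) v - letter i (letter j v)).
  by rewrite h addrC subrK.
case: eqP => // ij; congr (_ + _); rewrite -assoc1_basis // ij; exact: assoc1_diag.
Qed.

Lemma letter0 g : letter g 0 = 0. Proof. exact: (evalw0 [:: g]). Qed.

Lemma letterZ g a x : letter g (a *: x) = a *: letter g x.
Proof. by rewrite -[a *: x]addr0 letter_lin letter0 addr0. Qed.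

Lemma letterD g x y : letter g (x + y) = letter g x + letter g y.
Proof. by rewrite -[x]scale1r letter_lin !scale1r. Qed.

Lemma insL_sound i w v :
  (insL i w).1%:~R *: evalw (insL i w).2 v = letter i (evalw w v).
Proof.
elim: w => [|j w IH] /=; first by rewrite scale1r.
case: ifPn => [_|]; first by rewrite scale1r.
rewrite !negb_or -!ltnNge -!lt0n => /and5P[j8 ji j0 i0 i8].
have i08 : (0 < i < 8)%N by rewrite i0.
have j08 : (0 < j < 8)%N by rewrite j0.
case: eqP => [->|/eqP ij] /=; first by rewrite rmorphN1 scaleN1r LL_diag.
rewrite LL_swap // -IH rmorphN scaleNr; congr (- _).
by rewrite letterZ.
Qed.

Lemma insR_sound i w v : evalp (insR i w) v = letter (8 + i)%N (evalw w v).
Proof.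
elim: w => [|j w IH] /=; first by rewrite evalp_cons evalp_nil addr0 scale1r.
case: ifPn => [_|].
  by rewrite evalp_cons evalp_nil addr0 scale1r.
rewrite !negb_or -!ltnNge -!lt0n => /and4P[j8 j0 i0 i8].
have i08 : (0 < i < 8)%N by rewrite i0.
have j08 : (0 < j < 8)%N by rewrite j0.
rewrite RL_swap // evalp_cat -IH; congr (_ + _).
  rewrite /evalp big_map /= -[RHS]/(evalw [:: j] _) evalw_evalp; apply: eq_bigr => t _.
  by rewrite intrM -scalerA insL_sound.
case: ifP => _; first exact: evalp_nil.
rewrite !evalp_cons evalp_nil addr0 /= intrM -scalerA insL_sound.
by rewrite mulrNz intrM scaleNr -scalerA (insL_sound i) -(letterZ i) insL_sound.
Qed.

Lemma ins_sound g w v : evalp (ins g w) v = letter g (evalw w v).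
Proof.
rewrite /ins; case: ifPn => [_|]; first by rewrite evalp_cons evalp_nil addr0 insL_sound.
by rewrite -leqNgt => h; rewrite insR_sound subnKC.
Qed.

Lemma addm_sound c w p v : evalp (addm c w p) v = c%:~R *: evalw w v + evalp p v.
Proof.
elim: p => [|[d u] p IH] /=; first by rewrite evalp_cons.
case: eqP => [->|_]; last by rewrite !evalp_cons /= IH addrCA.
case: eqP => cd; rewrite !evalp_cons addrA -scalerDl -intrD ?cd //.
by rewrite scale0r add0r.
Qed.

Lemma collect_sound p v : evalp (collect p) v = evalp p v.
Proof. by elim: p => //= t p IH; rewrite addm_sound IH evalp_cons. Qed.

Lemma insp_sound g p v : evalp (insp g p) v = letter g (evalp p v).
Proof.
rewrite collect_sound; elim: p => [|t p IH] /=; first by rewrite !evalp_nil letter0.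
by rewrite evalp_cat evalp_cons letterD IH letterZ evalp_scale ins_sound.
Qed.

Lemma normp_sound p v : evalp (normp p) v = evalp p v.
Proof.
rewrite collect_sound; elim: p => [|t p IH] //=.
rewrite evalp_cat evalp_cons IH evalp_scale; congr (_ *: _ + _).
elim: t.2 => [|g w IHw] /=; first by rewrite evalp_cons evalp_nil addr0 scale1r.
by rewrite insp_sound IHw.
Qed.

Definition nullp p := forall v, evalp p v = 0.

(** The reflection step: an identity follows from a known one once their difference normalizes to
    the empty polynomial, which is a computation. *)
Lemma nullp_norm p q : nullp p -> nilp (normp (subp q p)) -> nullp q.
Proof.
move=> p0 /nilP h v; have := normp_sound (subp q p) v.
by rewrite h evalp_nil evalp_sub p0 subr0.
Qed.

Lemma nullp_sub p q : nullp p -> nullp q -> nullp (subp p q).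
Proof. by move=> hp hq v; rewrite evalp_sub hp hq subr0. Qed.

Lemma nullp_cat p q : nullp p -> nullp q -> nullp (p ++ q).
Proof. by move=> hp hq v; rewrite evalp_cat hp hq addr0. Qed.

Lemma nullp_mulr p q : nullp p -> nullp (mulp p q).
Proof. by move=> hp v; rewrite evalp_mul hp. Qed.

Lemma nullp_mull p q : nullp q -> nullp (mulp p q).
Proof. by move=> hq v; rewrite evalp_mul hq evalp0. Qed.

Lemma nullp_scale c p : nullp p -> nullp (scalep c p).
Proof. by move=> hp v; rewrite evalp_scale hp scaler0. Qed.

Lemma nullp_unscale c p : c != 0 -> nullp (scalep c p) -> nullp p.
Proof.
move=> c0 hp v; have := hp v; rewrite evalp_scale => /eqP.
by rewrite scaler_eq0 intr_eq0 (negbTE c0) => /eqP.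
Qed.

End MultiplicationAlgebra.

(** * Computed identities between left and right multiplications *)

Definition wordp (w : seq nat) : ncpoly := [:: (1, w)].

(* [R_j R_i - R_(e_i e_j) = [x, e_i, e_j] = [e_i, e_j, x] = L_(e_i e_j) - L_i L_j] *)
Definition relRR (i j : nat) : ncpoly :=
  [:: (1, [:: (8 + j)%N; (8 + i)%N]); (- tab_sgn i j, [:: (8 + tab_idx i j)%N]);
      (- tab_sgn i j, [:: tab_idx i j]); (1, [:: i; j])].

Definition commp (p : ncpoly) (g : nat) : ncpoly :=
  subp (mulp p (wordp [:: g])) (mulp (wordp [:: g]) p).

(* As [L_a^2 = -1], this keeps (twice) the monomials that commute with [L_a] if
   [e = -1] and those that anticommute with it if [e = 1]. *)
Definition filterp (e : int) (a : nat) (p : ncpoly) : ncpoly :=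
  p ++ scalep e (mulp (mulp (wordp [:: a]) p) (wordp [:: a])).

(* The commutator of [relRR] with [L_r] is linear in the right multiplications;
   the filter isolates the one by [e_i]. *)
Definition solveR (i p r a : nat) : ncpoly :=
  mulp (filterp 1 a (commp (relRR p i) r)) (wordp [:: tab_idx p r]).

(** Row i holds [(p, r, a)], with e_a equal to e_i e_r up to sign; row 0 is a placeholder. Modulo
    left multiplications, the commutator in [solveR] is [e_i, e_r, -] R_p + R_i [e_p, e_r, -]. As
    L_a commutes with L_a, L_i L_r and L_p L_r but anticommutes with L_(e_p e_r), the filter leaves
    only 2 R_i L_(e_p e_r). *)
Definition paramR (i : nat) : nat * nat * nat :=
  nth (0, 0, 0)%N [:: (0, 0, 0); (2, 4, 5); (1, 4, 6); (1, 4, 7); (1, 2, 6);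
                     (1, 2, 7); (1, 2, 4); (1, 2, 5)]%N i.

Definition exprR (i : nat) : ncpoly :=
  let: (p, r, a) := paramR i in scalep (-1) (solveR i p r a).

(** The volume element L_1 ... L_7 of Cl_7 is central with square 1; its value -1 selects one of the
    two irreducible representations. *)
Definition omega1 : ncpoly := [:: (1, [::]); (1, [:: 1; 2; 3; 4; 5; 6; 7]%N)].

(* The two ways of solving for [R_2] differ by a nonzero multiple of
   [1 + L_1 ... L_7]. *)
Definition omega_cert : ncpoly :=
  filterp (-1) 5 (mulp (subp (solveR 2 1 4 6)
    (mulp (filterp (-1) 2 (commp (relRR 1 2) 4)) (wordp [:: 4; 1]%N)))
   (wordp [:: 7; 5]%N)).

(* Eight times the projection onto the real part: on [Re M] each product
   [L_i L_j L_k] over an oriented Fano line [e_i e_j = e_k] acts as [-1]. *)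
Definition re8 : ncpoly :=
  (1, [::]) :: [seq (-1, w) | w <- [:: [:: 1; 2; 3]; [:: 1; 4; 5]; [:: 1; 7; 6];
     [:: 2; 4; 6]; [:: 2; 5; 7]; [:: 3; 4; 7]; [:: 3; 6; 5]]%N].

Definition assocp (i j : nat) : ncpoly :=
  [:: (1, [:: i; j]); (- tab_sgn i j, [:: tab_idx i j])].

Definition commutp (i : nat) : ncpoly := [:: (1, [:: (8 + i)%N]); (-1, [:: i])].

(** Eight times the operator taking x to Re x - sum_i e_i Re (e_i x), that is, to the sum of its
    components. *)
Definition resolp : ncpoly :=
  re8 ++ flatten [seq scalep (-1) (mulp (wordp [:: i]) (mulp re8 (wordp [:: i])))
                 | i <- iota 1 7].

(* On a real element, a word in the left multiplications acts as a signed [e_k]. *)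
Definition redw (w : seq nat) : int * nat :=
  foldr (fun g t => (tab_sgn g t.2 * t.1, tab_idx g t.2)) (1, 0%N) w.

Definition redp (p : ncpoly) : ncpoly :=
  collect [seq (t.1 * (redw t.2).1, [:: (redw t.2).2]) | t <- p].

Section RealPart.
Variables (R : realType) (V : completeNormedModType R).
Variables (lm : Oct R -> V -> V) (rm : V -> Oct R -> V).
Hypothesis HV : BanachOBimodule lm rm.
Local Notation nullp := (nullp lm rm).
Local Notation evalp := (evalp lm rm).
Local Notation letter := (letter lm rm).

Lemma evalp_wordp1 g v : evalp (wordp [:: g]) v = letter g v.
Proof. by rewrite evalp_cons evalp_nil addr0 scale1r. Qed.

Lemma relRR_null i j : (i < 8)%N -> (j < 8)%N -> nullp (relRR i j).
Proof.
move=> i8 j8 v; rewrite /relRR !evalp_cons evalp_nil addr0 /= !mulrNz.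
have := assoc_23 HV (oe R (inord i)) (oe R (inord j)) v.
rewrite -(assoc_12 HV) (assoc1_basis HV) // /assoc3 omul_oen // (rmZr HV).
rewrite -!(letterR lm rm) => h.
by rewrite !scaleNr !scale1r addrA -h [X in _ + X]addrC -[X in _ + X]opprB addrN.
Qed.

Lemma commp_null p g : nullp p -> nullp (commp p g).
Proof. by move=> h; apply: nullp_sub; [apply: nullp_mulr|apply: nullp_mull]. Qed.

Lemma filterp_null e a p : nullp p -> nullp (filterp e a p).
Proof.
move=> h; apply: nullp_cat => //; apply: nullp_scale; apply: nullp_mulr => //.
exact: nullp_mull.
Qed.

Lemma solveR_null i p r a : (i < 8)%N -> (p < 8)%N -> nullp (solveR i p r a).
Proof. by move=> *; apply/nullp_mulr/filterp_null/commp_null/relRR_null. Qed.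

Lemma exprR_null i : (i < 8)%N -> nullp (exprR i).
Proof.
move=> i8; rewrite /exprR; case E : (paramR i) => [[p r] a]; apply: nullp_scale.
apply: solveR_null => //.
have : all (fun i => ((paramR i).1.1 < 8)%N) (iota 0 8) by vm_compute.
by move=> /allP/(_ i); rewrite mem_iota E; apply.
Qed.

Lemma omega1_null : nullp omega1.
Proof.
have h : nullp omega_cert.
  apply/filterp_null/nullp_mulr => //; apply: nullp_sub; first exact: solveR_null.
  by apply/nullp_mulr/filterp_null/commp_null/relRR_null.
(* Normalization identifies [omega_cert] with twice [omega1]. *)
by apply: (@nullp_unscale _ _ _ _ 2) => //; apply: nullp_norm h _ => //; vm_compute.
Qed.

(* If [p (1 - L_1 ... L_7) = 0] formally, then [2 p = p (1 + L_1 ... L_7)] acts as [0]. *)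
Definition null_mod_omega (p : ncpoly) : bool :=
  nilp (normp (subp (scalep 2 p) (mulp p omega1))).

Lemma null_mod_omegaP p : null_mod_omega p -> nullp p.
Proof.
move=> h; apply: (@nullp_unscale _ _ _ _ 2) => //.
apply: (nullp_norm HV _ h); apply: nullp_mull => //; exact: omega1_null.
Qed.

Lemma iota17P (P : pred nat) i : all P (iota 1 7) -> (0 < i < 8)%N -> P i.
Proof. by move=> /allP/(_ i) h i8; apply: h; rewrite mem_iota. Qed.

Lemma assocp_re8_null i j : (0 < i < 8)%N -> (0 < j < 8)%N -> i != j ->
  nullp (mulp (assocp i j) re8) /\ nullp (mulp re8 (assocp i j)).
Proof.
move=> i8 j8 ij; have : all (fun i => all (fun j => (i == j) ||
    null_mod_omega (mulp (assocp i j) re8) && null_mod_omega (mulp re8 (assocp i j)))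
    (iota 1 7)) (iota 1 7) by vm_compute.
move=> /iota17P/(_ i8)/iota17P/(_ j8); rewrite (negbTE ij) => /andP[h1 h2].
by split; apply: null_mod_omegaP.
Qed.

(** Since [exprR i] acts as 0 and has the form 2 R_i plus left multiplications, subtracting it from
    twice the commutator eliminates R_i; what remains is a Clifford identity modulo [omega1]. *)
Lemma commutp_re8_null i : (0 < i < 8)%N ->
  nullp (mulp (commutp i) re8) /\ nullp (mulp re8 (commutp i)).
Proof.
move=> i8; have e : nullp (exprR i) by apply: exprR_null; case/andP: i8.
have : all (fun i =>
    null_mod_omega (mulp (subp (scalep 2 (commutp i)) (exprR i)) re8) &&
    null_mod_omega (mulp re8 (subp (scalep 2 (commutp i)) (exprR i)))) (iota 1 7).
  by vm_compute.
move=> /iota17P/(_ i8)/andP[/null_mod_omegaP h1 /null_mod_omegaP h2].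
split=> v; [have := h1 v|have := h2 v]; rewrite !evalp_mul // evalp_sub evalp_scale e;
  rewrite subr0 ?evalpZ // => /eqP; rewrite scaler_eq0 intr_eq0 => /eqP //.
Qed.

(** The empty word is counted eight times. A line word commutes with three of the L_g and
    anticommutes with four, so its terms -L_g w L_g add up to -w and cancel it. *)
Lemma resolp_eq v : evalp resolp v = 8%:R *: v.
Proof.
rewrite -(normp_sound HV); have -> : normp resolp = [:: (8%:Z, [::])] by vm_compute.
by rewrite evalp_cons evalp_nil addr0.
Qed.

(** * The projection onto the real part *)

Definition realp (x : V) : V := 8%:R^-1 *: evalp re8 x.

Lemma realp_lin a x y : realp (a *: x + y) = a *: realp x + realp y.
Proof. by rewrite /realp evalp_lin // scalerDr !scalerA mulrC. Qed.

Lemma realp0 : realp 0 = 0. Proof. by rewrite /realp evalp0 // scaler0. Qed.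

Lemma realpD x y : realp (x + y) = realp x + realp y.
Proof. by rewrite -[x]scale1r realp_lin !scale1r. Qed.

Lemma realpZ a x : realp (a *: x) = a *: realp x.
Proof. by rewrite -[a *: x]addr0 realp_lin realp0 addr0. Qed.

Lemma realpN x : realp (- x) = - realp x.
Proof. by rewrite -scaleN1r realpZ scaleN1r. Qed.

Lemma realpB x y : realp (x - y) = realp x - realp y.
Proof. by rewrite realpD realpN. Qed.

Lemma lm_sum (p : Oct R) x : lm p x = \sum_(i < 8) p ord0 i *: lm (oe R i) x.
Proof.
rewrite {1}[p]oct_basis_sum (big_morph (lm^~ x) (fun p q => lmDl HV p q x) (lm0l HV x)).
by apply: eq_bigr => i _; rewrite (lmZl HV).
Qed.

Lemma rm_sum (p : Oct R) x : rm x p = \sum_(i < 8) p ord0 i *: rm x (oe R i).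
Proof.
rewrite {1}[p]oct_basis_sum (big_morph (rm x) (rmDr HV x) (rm0r HV x)).
by apply: eq_bigr => i _; rewrite (rmZr HV).
Qed.

Lemma oeord (i : 'I_8) : oe R i = oe R (inord i).
Proof. by rewrite inord_val. Qed.

Lemma lm0r p : lm p 0 = 0.
Proof.
have := lm_linr HV 1 p 0 0; rewrite !scale1r addr0.
by move=> /(congr1 (fun z => z - lm p 0)); rewrite subrr addrK.
Qed.

Lemma lmZr p a x : lm p (a *: x) = a *: lm p x.
Proof. by rewrite -[a *: x]addr0 (lm_linr HV) lm0r addr0. Qed.

Lemma lmDr p x y : lm p (x + y) = lm p x + lm p y.
Proof. by rewrite -[x]scale1r (lm_linr HV) !scale1r. Qed.

Lemma lm_sumr p n (F : 'I_n -> V) : lm p (\sum_(i < n) F i) = \sum_(i < n) lm p (F i).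
Proof. exact: (big_morph (lm p) (lmDr p) (lm0r p)). Qed.

Lemma assoc1_sum (p q : Oct R) x : assoc1 lm p q x =
  \sum_(i < 8) \sum_(j < 8) (p ord0 i * q ord0 j) *: assoc1 lm (oe R i) (oe R j) x.
Proof.
have lsum n (F : 'I_n -> Oct R) : lm (\sum_(i < n) F i) x = \sum_(i < n) lm (F i) x.
  exact: (big_morph (lm^~ x) (fun p q => lmDl HV p q x) (lm0l HV x)).
rewrite /assoc1 [lm p _]lm_sum [lm q x]lm_sum omul_sum lsum -sumrB; apply: eq_bigr => i _.
rewrite lsum lm_sumr scaler_sumr -sumrB; apply: eq_bigr => j _.
by rewrite (lmZl HV) lmZr scalerA scalerBr.
Qed.

Lemma letter_oe0 v : letter 0 v = v.
Proof. by rewrite letterL // oe0E (lm_one HV). Qed.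

Lemma tab0l j : (j < 8)%N -> tab_sgn 0 j = 1 /\ tab_idx 0 j = j.
Proof. by case: j => [|[|[|[|[|[|[|[|j]]]]]]]]. Qed.

Lemma tab0r i : (i < 8)%N -> tab_sgn i 0 = 1 /\ tab_idx i 0 = i.
Proof. by case: i => [|[|[|[|[|[|[|[|i]]]]]]]]. Qed.

(* Associators with [1] or with a repeated imaginary unit vanish. *)
Lemma assoc1_basis_trivial (f : V -> V) (i j : 'I_8) x : f 0 = 0 ->
  ((0 < i)%N -> (0 < j)%N -> i != j ->
    f (assoc1 lm (oe R i) (oe R j) x) = 0) ->
  f (assoc1 lm (oe R i) (oe R j) x) = 0.
Proof.
move=> f0 h; have [<-|ij] := eqVneq i j; first by rewrite (assoc1_diag HV) f0.
case: (posnP i) => [i0|i0].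
  rewrite oeord (oeord j) (assoc1_basis HV) // i0.
  by have [-> ->] := tab0l (ltn_ord j); rewrite scale1r letter_oe0 subrr.
case: (posnP j) => [j0|j0]; last exact: h.
rewrite oeord (oeord j) (assoc1_basis HV) // j0.
by have [-> ->] := tab0r (ltn_ord i); rewrite scale1r letter_oe0 subrr.
Qed.

Lemma evalp_assocp i j v : (i < 8)%N -> (j < 8)%N ->
  evalp (assocp i j) v = - assoc1 lm (oe R (inord i)) (oe R (inord j)) v.
Proof.
move=> i8 j8; rewrite (assoc1_basis HV) // !evalp_cons evalp_nil addr0 /= mulrNz.
by rewrite scale1r scaleNr opprB.
Qed.

(** By bilinearity only associators of basis vectors matter, and [assocp_re8_null] kills those with
    distinct imaginary units. *)
Lemma realp_assoc (p q : Oct R) x : realp (assoc1 lm p q x) = 0.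
Proof.
have rsum n (F : 'I_n -> V) : realp (\sum_(i < n) F i) = \sum_(i < n) realp (F i).
  exact: (big_morph realp realpD realp0).
rewrite assoc1_sum rsum big1 // => i _; rewrite rsum big1 // => j _.
rewrite realpZ (assoc1_basis_trivial realp0) ?scaler0 // => i0 j0 ij.
have i8 : (0 < i < 8)%N by rewrite i0 ltn_ord.
have j8 : (0 < j < 8)%N by rewrite j0 ltn_ord.
have [_ /(_ x)] := assocp_re8_null i8 j8 ij.
rewrite evalp_mul // evalp_assocp // -!oeord /realp => h.
by apply: oppr_inj; rewrite -scalerN -(scaleN1r (assoc1 _ _ _ _)) in h *;
  rewrite -scaleN1r -evalpZ // h scaler0 oppr0.
Qed.

Lemma assoc_realp (p q : Oct R) x : assoc1 lm p q (realp x) = 0.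
Proof.
rewrite assoc1_sum big1 // => i _; rewrite big1 // => j _.
rewrite (@assoc1_basis_trivial id) ?scaler0 // => i0 j0 ij.
have i8 : (0 < i < 8)%N by rewrite i0 ltn_ord.
have j8 : (0 < j < 8)%N by rewrite j0 ltn_ord.
have [/(_ (8%:R^-1 *: x)) + _] := assocp_re8_null i8 j8 ij.
rewrite evalp_mul // evalpZ // -/(realp x) evalp_assocp // -!oeord => /eqP.
by rewrite oppr_eq0 => /eqP.
Qed.

Lemma evalp_commutp i v : (i < 8)%N ->
  evalp (commutp i) v = rm v (oe R (inord i)) - lm (oe R (inord i)) v.
Proof.
move=> i8; rewrite !evalp_cons evalp_nil addr0 /= mulrNz scaleNr !scale1r.
by rewrite letterR letterL.
Qed.

Lemma realp_rm (p : Oct R) x : realp (rm x p) = realp (lm p x).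
Proof.
have rsum n (F : 'I_n -> V) : realp (\sum_(i < n) F i) = \sum_(i < n) realp (F i).
  exact: (big_morph realp realpD realp0).
rewrite rm_sum lm_sum !rsum; apply: eq_bigr => i _; rewrite !realpZ; congr (_ *: _).
case: (posnP i) => [i0|i0].
  by rewrite oeord i0 oe0E (lm_one HV) (rm_one HV).
have i8 : (0 < i < 8)%N by rewrite i0 ltn_ord.
have [_ /(_ x)] := commutp_re8_null i8.
rewrite evalp_mul // evalp_commutp // -!oeord => h.
by apply/eqP; rewrite -subr_eq0 -realpB /realp h scaler0.
Qed.

Lemma rm_realp (p : Oct R) x : lm p (realp x) = rm (realp x) p.
Proof.
rewrite rm_sum lm_sum; apply: eq_bigr => i _; congr (_ *: _).
case: (posnP i) => [i0|i0].
  by rewrite oeord i0 oe0E (lm_one HV) (rm_one HV).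
have i8 : (0 < i < 8)%N by rewrite i0 ltn_ord.
have [/(_ (8%:R^-1 *: x)) + _] := commutp_re8_null i8.
rewrite evalp_mul // evalpZ // -/(realp x) evalp_commutp // -!oeord => /eqP.
by rewrite subr_eq0 => /eqP ->.
Qed.

Lemma ReM_realp x : Defs.ReM lm rm (realp x).
Proof. by split=> [p|p q]; [exact: rm_realp|exact: assoc_realp]. Qed.

Lemma realp_resolution x : x = \sum_(i < 8)
  lm (oe R i) (realp (if i == ord0 then x else - lm (oe R i) x)).
Proof.
have e : x = 8%:R^-1 *: evalp resolp x.
  by rewrite resolp_eq scalerA mulVf ?scale1r // pnatr_eq0.
rewrite {1}e /resolp evalp_cat scalerDr big_ord_recl (lm_one HV); congr (_ + _).
rewrite (_ : iota 1 7 = [seq (val i).+1 | i <- enum 'I_7]); last first.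
  by rewrite map_comp val_enum_ord.
rewrite evalp_flatten big_map big_map big_enum scaler_sumr.
apply: eq_bigr => i _; rewrite evalp_scale !evalp_mul //.
have i8 : ((val i).+1 < 8)%N by exact: ltn_ord i.
have -> : lift ord0 i = inord (val i).+1 by apply: ord_inj; rewrite inordK.
have -> : (inord (val i).+1 == ord0 :> 'I_8) = false by rewrite -val_eqE /= inordK.
rewrite !evalp_wordp1 !letterL //.
by rewrite realpN -scaleN1r lmZr /realp lmZr rmorphN1 !scalerA mulrC.
Qed.

Lemma ReDecomp_realp x : ReDecomp lm rm x
  (fun i => realp (if i == ord0 then x else - lm (oe R i) x)).
Proof. by split=> [i|]; [exact: ReM_realp|exact: realp_resolution]. Qed.

Lemma redw_sound w m : Defs.ReM lm rm m -> all (fun g => (g < 8)%N) w ->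
  evalw lm rm w m = (redw w).1%:~R *: letter (redw w).2 m /\ ((redw w).2 < 8)%N.
Proof.
move=> [_ mA]; elim: w => [|g w IH] /=; first by rewrite scale1r letter_oe0.
move=> /andP[g8 /IH[-> k8]]; split; last exact: tab_idx_lt.
rewrite (letterZ HV) mulrC intrM -scalerA; congr (_ *: _).
have := mA (oe R (inord g)) (oe R (inord (redw w).2)).
by rewrite (assoc1_basis HV) // => /eqP; rewrite subr_eq0 => /eqP <-.
Qed.

Lemma redp_sound p m : Defs.ReM lm rm m -> all (fun t => all (fun g => (g < 8)%N) t.2) p ->
  evalp (redp p) m = evalp p m.
Proof.
move=> mR; rewrite /redp collect_sound // /evalp big_map.
elim: p => [|t p IH] /=; first by rewrite !big_nil.
move=> /andP[/(redw_sound mR)[e _] /IH]; rewrite !big_cons => ->; congr (_ + _).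
by rewrite e intrM -scalerA.
Qed.

Lemma realp_ReM m : Defs.ReM lm rm m -> realp m = m.
Proof.
move=> mR; rewrite /realp -redp_sound //.
have -> : redp re8 = [:: (8%:Z, [:: 0%N])] by vm_compute.
by rewrite evalp_cons evalp_nil addr0 /= letter_oe0 scalerA mulVf ?scale1r ?pnatr_eq0.
Qed.

(** The three line words through e_i act on e_i m as -1 and the four others as +1, and 1 + 3 - 4 =
    0. *)
Lemma realp_lm_ReM m (i : 'I_8) : Defs.ReM lm rm m -> i != ord0 -> realp (lm (oe R i) m) = 0.
Proof.
move=> mR i0; have i8 : (0 < i < 8)%N by rewrite ltn_ord andbT lt0n.
have /iota17P/(_ i8)/andP[a8 /nilP h] : all (fun i =>
  all (fun t => all (fun g => (g < 8)%N) t.2) (mulp re8 (wordp [:: i])) &&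
  nilp (redp (mulp re8 (wordp [:: i])))) (iota 1 7) by vm_compute.
have := redp_sound mR a8; rewrite h evalp_nil evalp_mul // evalp_wordp1.
by rewrite letterL // -oeord /realp => <-; rewrite scaler0.
Qed.

Lemma realp_ReDecomp x xs : ReDecomp lm rm x xs -> realp x = xs ord0.
Proof.
move=> [xsR ->]; rewrite (big_morph realp realpD realp0) (bigD1 ord0) //= big1 => [|i i0].
  by rewrite addr0 (lm_one HV) realp_ReM.
exact: realp_lm_ReM.
Qed.

(** A decomposition exists by [ReDecomp_realp], and every decomposition has [realp x] as its
    e_0-component, so the choice operator has only one value to return. *)
Lemma ReV_realp x : Defs.ReV lm rm x = realp x.
Proof.
have : exists x0, exists xs, ReDecomp lm rm x xs /\ xs ord0 = x0.
  by eexists; eexists; split; [exact: ReDecomp_realp|].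
by move=> /(epsilon_spec (inhabits 0)) [xs [/realp_ReDecomp -> ->]].
Qed.

(** Up to sign, the components of y in [realp_resolution] are the real parts of the e_i y, which by
    [realp_rm] are those of the y e_i. *)
Lemma realp_rm_eq0 y : (forall p, realp (rm y p) = 0) -> y = 0.
Proof.
move=> h; rewrite [LHS]realp_resolution big1 // => i _.
have -> : realp (if i == ord0 then y else - lm (oe R i) y) = 0.
  case: ifP => _; first by have := h (oone R); rewrite (rm_one HV).
  by rewrite realpN -realp_rm h oppr0.
exact: lm0r.
Qed.

Lemma ReM_neq0 : (exists v : V, v != 0) -> exists2 m, Defs.ReM lm rm m & m != 0.
Proof.
move=> [v v0]; apply: contrapT => h; move/eqP: v0; apply.
apply: realp_rm_eq0 => p; apply: contrapT => /eqP m0; apply: h.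
by exists (realp (rm v p)) => //; exact: ReM_realp.
Qed.

(** * Right multiplication of real elements and operators in [B_RO] *)

Lemma ReM_rmA m p q : Defs.ReM lm rm m -> rm (rm m p) q = rm m (omul p q).
Proof.
move=> [_ mA]; have := assoc_23 HV p q m; rewrite -(assoc_12 HV) mA /assoc3.
by move=> /eqP; rewrite eq_sym subr_eq0 => /eqP.
Qed.

Lemma rmBl x y p : rm (x - y) p = rm x p - rm y p.
Proof.
by rewrite addrC -scaleN1r (rm_linl HV) scaleN1r addrC.
Qed.

(* Moving [f] inside the real part, [Re (f (v p) q) = Re (f (v (p q)))
   = Re (f v (p q)) = Re ((f v p) q)] for all [q]. *)
Lemma B_RO_rm_ReM f v p : B_RO lm rm f -> Defs.ReM lm rm v -> f (rm v p) = rm (f v) p.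
Proof.
move=> [_ fRO] vR; apply/eqP; rewrite -subr_eq0; apply/eqP.
apply: realp_rm_eq0 => q; have E x r : realp (rm (f x) r) = realp (f (rm x r)).
  by apply/eqP; rewrite -subr_eq0 -realpB -ReV_realp fRO.
rewrite rmBl realpB E ReM_rmA // -E -realpB; apply/eqP; rewrite -oppr_eq0 -realpN opprB.
by rewrite -/(assoc3 rm (f v) p q) -(assoc_23 HV) -(assoc_12 HV) realp_assoc.
Qed.

End RealPart.

(** * Bounded operators *)

Section BoundedOperators.
Variables (R : realType) (V : completeNormedModType R).
Implicit Types f g : V -> V.

Section Linearity.
Variable f : V -> V.
Hypothesis Hf : bounded_lin f.

Lemma bl_lin a x y : f (a *: x + y) = a *: f x + f y.
Proof. by case: Hf. Qed.

Lemma blD x y : f (x + y) = f x + f y.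
Proof. by rewrite -[x]scale1r bl_lin !scale1r. Qed.

Lemma bl0 : f 0 = 0.
Proof. by have /(congr1 (fun z => z - f 0)) := blD 0 0; rewrite addr0 subrr addrK. Qed.

Lemma blZ a x : f (a *: x) = a *: f x.
Proof. by rewrite -[a *: x]addr0 bl_lin bl0 addr0. Qed.

Lemma blN x : f (- x) = - f x.
Proof. by rewrite -scaleN1r blZ scaleN1r. Qed.

Lemma blB x y : f (x - y) = f x - f y.
Proof. by rewrite blD blN. Qed.

Lemma bl_bound : exists2 C : R, 0 < C & forall x, `|f x| <= C * `|x|.
Proof.
have [_ [C hC]] := Hf; exists (Num.max C 1); first by rewrite lt_max ltr01 orbT.
move=> x; apply: le_trans (hC x) _; apply: ler_wpM2r => //.
by rewrite le_max lexx.
Qed.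

Lemma bl_continuous : continuous f.
Proof.
have [C C0 hC] := bl_bound; move=> x; apply/cvgrPdist_lt => e e0.
have e'0 : 0 < C^-1 * e by rewrite mulr_gt0 // invr_gt0.
near=> y.
rewrite -blB; apply: le_lt_trans (hC _) _; rewrite -ltr_pdivlMl //.
Unshelve. all: by end_near. Qed.

Lemma bl_ker_closed : closed [set x | f x = 0].
Proof.
have -> : [set x | f x = 0] = (fun x => `|f x|) @^-1` [set 0].
  by apply/seteqP; split => x /= => [->|/eqP]; rewrite ?normr0 // normr_eq0 => /eqP.
apply: preimage_closed; last exact: closed_eq.
by move=> x _; apply: cvg_norm; exact: bl_continuous.
Qed.

End Linearity.

Lemma bl_comp f g : bounded_lin f -> bounded_lin g -> bounded_lin (f \o g).
Proof.
move=> Hf Hg; split=> [a x y|]; first by rewrite /= (bl_lin Hg) (bl_lin Hf).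
have [C C0 hC] := bl_bound Hf; have [D D0 hD] := bl_bound Hg.
exists (C * D) => x /=; apply: le_trans (hC _) _; rewrite -mulrA.
by rewrite ler_wpM2l // ltW.
Qed.

Lemma bl_sub f g : bounded_lin f -> bounded_lin g -> bounded_lin (fun x => f x - g x).
Proof.
move=> Hf Hg; split=> [a x y|].
  by rewrite (bl_lin Hf) (bl_lin Hg) scalerBr opprD addrACA.
have [C C0 hC] := bl_bound Hf; have [D D0 hD] := bl_bound Hg.
exists (C + D) => x; apply: le_trans (ler_normB _ _) _; rewrite mulrDl.
exact: lerD.
Qed.

Lemma bl_iter f n : bounded_lin f -> bounded_lin (iter n f).
Proof.
move=> Hf; elim: n => [|n IH]; last exact: (bl_comp Hf IH).
by split=> // ; exists 1 => x; rewrite mul1r.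
Qed.

Lemma opnorm_ge0_bound f : bounded_lin f ->
  0 <= opnorm f /\ forall x, `|f x| <= opnorm f * `|x|.
Proof.
move=> Hf; have [C C0 hC] := bl_bound Hf.
set E := [set `|f x| | x in [set x : V | `|x| <= 1]].
have E0 : E 0 by exists 0; rewrite /= ?normr0 ?ler01 // (bl0 Hf) normr0.
have Eub : has_ubound E.
  exists C => _ [x x1 <-]; apply: le_trans (hC x) _.
  by rewrite -{2}[C]mulr1 ler_wpM2l // ltW.
split; first exact: ub_le_sup.
move=> x; have [->|x0] := eqVneq x 0; first by rewrite (bl0 Hf) !normr0 mulr0.
have nx : 0 < `|x| by rewrite normr_gt0.
have : E (`|x|^-1 * `|f x|).
  exists (`|x|^-1 *: x); first by rewrite /= normrZ normfV normr_id mulVf ?gt_eqF.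
  by rewrite (blZ Hf) normrZ normfV normr_id.
by move=> /(ub_le_sup Eub); rewrite -/(opnorm f) mulrC ler_pdivrMr.
Qed.

Lemma affine_fixpoint (U : set V) (G : V -> V) (q : R) (y : V) :
  closed U -> U !=set0 -> (forall x, U x -> U (y + G x)) -> bounded_lin G ->
  0 <= q -> q < 1 -> (forall x, `|G x| <= q * `|x|) -> exists2 u, U u & u = y + G u.
Proof.
move=> Ucl Une UG HG q0 q1 hq.
have fU : set_fun U U (fun x => y + G x) by move=> x /UG.
have [] := @banach_fixed_point R V U (mkfun_fun fU) _ Ucl Une.
  exists (NngNum q0); split=> //= -[a b] _ /=.
  by rewrite /mkfun opprD addrACA subrr add0r -(blB HG).
by move=> u Uu e; exists u.
Qed.

(* Neumann's lemma, with the inverse localized to a closed subspace [U]: the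
   inverse solves [u = B (x + K u)] by a contraction of [U]. *)
Lemma inverse_perturbation (A B K : V -> V) (cB cK : R) :
  inverse_in_BR A B -> bounded_lin K ->
  0 <= cB -> 0 <= cK -> cB * cK < 1 ->
  (forall x, `|B x| <= cB * `|x|) -> (forall x, `|K x| <= cK * `|x|) ->
  exists2 S, inverse_in_BR (fun x => A x - K x) S &
    forall U : set V, closed U -> (forall x y, U x -> U y -> U (x + y)) ->
      (forall x, U x -> U (B x)) -> (forall x, U x -> U (K x)) ->
      forall x, U x -> U (S x).
Proof.
move=> [HB [AB BA]] HK cB0 cK0 c1 hB hK.
have HBK : bounded_lin (B \o K) by exact: bl_comp.
have hBK x : `|(B \o K) x| <= cB * cK * `|x|.
  by apply: le_trans (hB _) _; rewrite -mulrA ler_wpM2l.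
have sol (U : set V) x : closed U -> (forall x y, U x -> U y -> U (x + y)) ->
    (forall x, U x -> U (B x)) -> (forall x, U x -> U (K x)) -> U x ->
    exists2 u, U u & u = B x + (B \o K) u.
  move=> Ucl UD UB UK Ux; apply: (affine_fixpoint Ucl) HBK _ c1 hBK.
  - by exists x.
  - by move=> z Uz; apply: UD; [exact: UB|exact/UB/UK].
  - exact: mulr_ge0.
(* Uniqueness of the fixed point makes the chosen solution [S] linear, gives [cancel] on one side,
   and identifies [S x] with the solution found inside [U]. *)
have uniq u u' x : u = B x + (B \o K) u -> u' = B x + (B \o K) u' -> u = u'.
  move=> e e'; apply/eqP; rewrite -subr_eq0 -normr_le0.
  have : `|u - u'| <= cB * cK * `|u - u'|.
    by rewrite {1}e {1}e' opprD addrACA subrr add0r -(blB HBK).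
  have := normr_ge0 (u - u'); nra.
have ex x : exists u, u = B x + (B \o K) u.
  have [u _ e] := sol setT x closedT (fun _ _ _ _ => I) (fun _ _ => I) (fun _ _ => I) I.
  by exists u.
pose S x := projT1 (cid (ex x)).
have SE x : S x = B x + (B \o K) (S x) by exact: projT2 (cid (ex x)).
exists S.
  split; [split|split].
  - move=> a x y; apply: (uniq _ _ (a *: x + y)); first exact: SE.
    by rewrite {1}(SE x) {1}(SE y) (bl_lin HB) (bl_lin HBK) scalerDr addrACA.
  - exists (cB / (1 - cB * cK)) => x; have := SE x.
    move=> /(congr1 (fun z => `|z|)) e.
    have h : `|S x| <= cB * `|x| + cB * cK * `|S x|.
      by rewrite {1}e; apply: le_trans (ler_normD _ _) _; apply: lerD.
    rewrite mulrAC ler_pdivlMr ?subr_gt0 //.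
    by move: h; lra.
  - move=> x; apply: (uniq _ _ (A x - K x)); first exact: SE.
    by rewrite /= -(blD HB) subrK AB.
  - by move=> x; rewrite {1}SE /= -(blD HB) BA addrK.
move=> U Ucl UD UB UK x Ux; have [u Uu e] := sol U x Ucl UD UB UK Ux.
by rewrite (uniq _ _ _ (SE x) e).
Qed.

End BoundedOperators.

(** * A Liouville theorem *)

Section Liouville.
Variables (R : realType) (V : normedModType R).

(* If [F 0 0 <> 0], then [|F| + eps |.|^2] attains its maximum over a large square in
   the interior, where the four-point estimate contradicts maximality. *)
Lemma four_point_liouville (F : R -> R -> V) :
  (forall a b e, 0 < e -> exists2 d, 0 < d & forall x y,
     `|x - a| < d -> `|y - b| < d -> `|F x y - F a b| < e) ->
  (forall a b, exists M d, 0 < d /\ forall h, 0 < h -> h < d ->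
     `|F (a + h) b + F (a - h) b + F a (b + h) + F a (b - h) - 4 *: F a b|
       <= M * h ^+ 3) ->
  (forall e, 0 < e -> exists2 r, 0 < r &
     forall a b, r ^+ 2 <= a ^+ 2 + b ^+ 2 -> `|F a b| < e) ->
  F 0 0 = 0.
Proof.
move=> Fc F4 Finf; apply/eqP/negP => /negP F0.
have D0 : 0 < `|F 0 0| by rewrite normr_gt0.
set D := `|F 0 0| in D0.
have [r r0 Fr] : exists2 r, 0 < r &
    forall a b, r ^+ 2 <= a ^+ 2 + b ^+ 2 -> `|F a b| < D / 2.
  by apply: Finf; rewrite divr_gt0.
(* With this value the penalty [eps * |.|^2] is at most [D / 2] on the whole square of half-side
   r. *)
pose eps := D / (4 * r ^+ 2).
have r20 : 0 < r ^+ 2 by rewrite exprn_gt0.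
have eps0 : 0 < eps by rewrite divr_gt0 // mulr_gt0.
have epsE : eps * (2 * r ^+ 2) = D / 2 by rewrite /eps; field; rewrite gt_eqF.
pose u (p : R * R) : R := `|F p.1 p.2| + eps * (p.1 ^+ 2 + p.2 ^+ 2).
have uc : continuous u.
  move=> -[a b]; apply: cvgD.
    apply: (@cvg_norm _ _ _ _ _ (fun p : R * R => F p.1 p.2) (F a b)).
    apply/cvgrPdist_lt => e e0; have [d d0 Fd] := Fc a b e e0.
    exists (ball a d, ball b d); first by split; exact: nbhsx_ballx.
    move=> [x y] [/= xa yb].
    by rewrite distrC Fd // distrC.
  apply: cvgM; first exact: cvg_cst.
  apply: cvgD.
    by apply: (@cvg_comp _ _ _ fst (fun x : R => x ^+ 2));
      [exact: cvg_fst|exact: exprn_continuous].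
  by apply: (@cvg_comp _ _ _ snd (fun x : R => x ^+ 2));
    [exact: cvg_snd|exact: exprn_continuous].
pose Q : set (R * R) := `[- r, r] `*` `[- r, r].
have Qc : compact Q by apply: compact_setX; exact: segment_compact.
have Q0 : Q (0, 0) by split => /=; rewrite in_itv /= oppr_le0 ltW.
have [[a b] + umax] := compact_EVT_max (ex_intro _ _ Q0) Qc (continuous_subspaceT uc).
rewrite inE => -[/=]; rewrite !in_itv /= => /andP[ra ar] /andP[rb br].
have um x y : - r <= x -> x <= r -> - r <= y -> y <= r ->
    `|F x y| + eps * (x ^+ 2 + y ^+ 2) <= `|F a b| + eps * (a ^+ 2 + b ^+ 2).
  move=> x1 x2 y1 y2; apply: (umax (x, y)); rewrite inE.
  by split; rewrite /= in_itv /= ?x1 ?y1.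
(* A maximum at distance at least r would be below [D / 2 + D / 2], the value at the origin; so the
   maximum lies in the open disc, inside the square. *)
have [rab|rab] := leP (r ^+ 2) (a ^+ 2 + b ^+ 2).
  have ab : a ^+ 2 + b ^+ 2 <= 2 * r ^+ 2 by nra.
  have := um 0 0; rewrite expr0n addr0 mulr0 addr0 -/D oppr_le0 ltW // => /(_ isT isT isT isT).
  have := Fr a b rab; have : eps * (a ^+ 2 + b ^+ 2) <= D / 2.
    by rewrite -epsE ler_wpM2l // ltW.
  lra.
have [M [d [d0 Fd]]] := F4 a b.
have ar' : `|a| < r by rewrite ltr_norml; apply/andP; split; nra.
have br' : `|b| < r by rewrite ltr_norml; apply/andP; split; nra.
(* The bounds on [h] keep the four points in the square and the estimate valid, and give
   [M * h <= 2 * eps]. *)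
pose h := Num.min (d / 2) (Num.min (Num.min (r - `|a|) (r - `|b|)) (2 * eps / (`|M| + 1))).
have M0 : 0 < `|M| + 1 by rewrite ltr_wpDl.
have h0 : 0 < h by rewrite !lt_min !subr_gt0 ar' br' !divr_gt0 // mulr_gt0.
have : h <= h by []; rewrite {2}/h !le_min => /and3P[hd /andP[ha hb]].
rewrite ler_pdivlMr // => hM.
have := Fd h h0 _; move=> /(_ ltac:(lra)) Fh.
have := ler_norm a; have := ler_norm b; have := ler_norm (- a); have := ler_norm (- b).
rewrite !normrN => b1 a1 b2 a2.
have u1 := um (a + h) b ltac:(lra) ltac:(lra) rb br.
have u2 := um (a - h) b ltac:(lra) ltac:(lra) rb br.
have u3 := um a (b + h) ra ar ltac:(lra) ltac:(lra).
have u4 := um a (b - h) ra ar ltac:(lra) ltac:(lra).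
set W := (X in `|X - _|) in Fh.
have W4 : `|W| <= `|F (a + h) b| + `|F (a - h) b| + `|F a (b + h)| + `|F a (b - h)|.
  by rewrite /W; do 3![apply: le_trans (ler_normD _ _) _; rewrite lerD2r].
have N4 : 4 * `|F a b| <= `|W| + M * h ^+ 3.
  have -> : 4 * `|F a b| = `|4 *: F a b| by rewrite normrZ ger0_norm.
  rewrite -[4 *: _](subKr W) (le_trans (ler_normB _ _)) // lerD2l.
  by rewrite -[leLHS]normrN opprB in Fh *.
have Mh : M * h <= 2 * eps.
  by apply: le_trans hM; rewrite mulrC ler_pM2l // (le_trans (ler_norm _)) // lerDl.
have h2 : 0 < h ^+ 2 by rewrite exprn_gt0.
have : M * h ^+ 3 <= 2 * eps * h ^+ 2 by rewrite exprS mulrA ler_pM2r.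
have : 0 < eps * h ^+ 2 by rewrite mulr_gt0.
(* The four penalties exceed four times the central one by [4 * eps * h ^+ 2], while the remainder
   is at most [2 * eps * h ^+ 2]. *)
move: u1 u2 u3 u4 W4 N4; clear; lra.
Qed.

End Liouville.

(** * Resolvents compatible with a complex structure *)

Lemma sqrt_sqrD_le (R : rcfType) (x y : R) : Num.sqrt (x ^+ 2 + y ^+ 2) <= `|x| + `|y|.
Proof.
rewrite -[leRHS]ger0_norm ?addr_ge0 // -(sqrtr_sqr (`|x| + `|y|)) ler_sqrt ?sqr_ge0 //.
have ex : x ^+ 2 = `|x| ^+ 2 by rewrite real_normK ?num_real.
have ey : y ^+ 2 = `|y| ^+ 2 by rewrite real_normK ?num_real.
by rewrite ex ey sqrrD addrAC lerDl mulrn_wge0 // mulr_ge0.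
Qed.

Section ComplexStructure.
Variables (R : realType) (V : completeNormedModType R) (j : V -> V).
Hypothesis jb : bounded_lin j.
Hypothesis jj : forall x, j (j x) = - x.

Definition jscale (a b : R) (x : V) : V := a *: x + b *: j x.

Hypothesis norm_jscale :
  forall a b x, `|jscale a b x| = Num.sqrt (a ^+ 2 + b ^+ 2) * `|x|.

Lemma jscale_bl a b : bounded_lin (jscale a b).
Proof.
split; last by exists (Num.sqrt (a ^+ 2 + b ^+ 2)) => x; rewrite norm_jscale.
move=> c x y; rewrite /jscale (bl_lin jb) !scalerDr !scalerA addrACA (mulrC a) (mulrC b).
by [].
Qed.

Lemma jscaleM a b c d x :
  jscale a b (jscale c d x) = jscale (a * c - b * d) (a * d + b * c) x.
Proof.
rewrite /jscale (bl_lin jb) (blZ jb) jj !scalerDr !scalerA scalerBl scalerDl.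
by rewrite scalerN [X in _ + X = _]addrC addrACA.
Qed.

(** All powers are required at once, so that the set is stable under [Q]. *)
Definition commuting_set (Q : V -> V) : set V :=
  [set w | forall n, iter n Q (j w) = j (iter n Q w)].

Section CommutingSet.
Variable Q : V -> V.
Hypothesis Qb : bounded_lin Q.
Local Notation W := (commuting_set Q).

Lemma commuting_set_closed : closed W.
Proof.
have -> : W = \bigcap_n [set w | iter n Q (j w) - j (iter n Q w) = 0].
  apply/seteqP; split=> w h n; first by move=> _ /=; rewrite h subrr.
  by apply/eqP; rewrite -subr_eq0; apply/eqP; exact: h.
apply: closed_bigI => n _; apply: bl_ker_closed; apply: bl_sub.
  exact: (bl_comp (bl_iter n Qb) jb).
exact: (bl_comp jb (bl_iter n Qb)).
Qed.

Lemma commuting_setD x y : W x -> W y -> W (x + y).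
Proof.
by move=> Wx Wy n; rewrite (blD jb) !(blD (bl_iter n Qb)) (blD jb) Wx Wy.
Qed.

Lemma commuting_setZ a x : W x -> W (a *: x).
Proof. by move=> Wx n; rewrite (blZ jb) !(blZ (bl_iter n Qb)) (blZ jb) Wx. Qed.

Lemma commuting_setj x : W x -> W (j x).
Proof. by move=> Wx n; rewrite jj (blN (bl_iter n Qb)) Wx jj. Qed.

Lemma commuting_set_op x : W x -> W (Q x).
Proof. by move=> Wx n; have := Wx n.+1; rewrite !iterSr -(Wx 1%N). Qed.

Lemma commuting_set_jscale a b x : W x -> W (jscale a b x).
Proof.
by move=> Wx; apply: commuting_setD; apply: commuting_setZ => //; exact: commuting_setj.
Qed.

Lemma iter_jscale n a b x : W x -> iter n Q (jscale a b x) = jscale a b (iter n Q x).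
Proof.
by move=> Wx; rewrite /jscale (bl_lin (bl_iter n Qb)) (blZ (bl_iter n Qb)) Wx.
Qed.

(* [B] and [K] act on [W] by operators commuting with [j], hence so does the inverse
   of [A - K]. *)
Lemma perturbation_commuting (A B K : V -> V) (cB cK : R) :
  inverse_in_BR A B -> bounded_lin K ->
  0 <= cB -> 0 <= cK -> cB * cK < 1 ->
  (forall x, `|B x| <= cB * `|x|) -> (forall x, `|K x| <= cK * `|x|) ->
  (forall x, W x -> W (B x) /\ B (j x) = j (B x)) ->
  (forall x, W x -> W (K x) /\ K (j x) = j (K x)) ->
  exists2 S, inverse_in_BR (fun x => A x - K x) S & W `<=` commuting_set S.
Proof.
move=> BA Kb cB0 cK0 c1 hB hK WB WK.
have [S Sinv SW] := inverse_perturbation BA Kb cB0 cK0 c1 hB hK.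
have {}SW : forall x, W x -> W (S x).
  apply: SW; [exact: commuting_set_closed|exact: commuting_setD| |].
    by move=> x /WB[].
  by move=> x /WK[].
exists S => // w Ww; case: (Sinv) => Sb [SA AS]; case: BA => Bb [AB BA].
have Sj x : W x -> S (j x) = j (S x).
  (* It suffices that A - K sends [j (S x)] to [j x]. This is obtained by moving j through
     [S x = B (x + K (S x))], as B and K commute with j on W. *)
  move=> Wx; rewrite -[RHS]SA; congr S.
  have WSx := SW x Wx.
  have e : S x = B (x + K (S x)).
    by have := AS x => /(congr1 (+%R^~ (K (S x)))); rewrite subrK => <-; rewrite AB.
  have WxK : W (x + K (S x)) by apply: commuting_setD => //; case: (WK _ WSx).
  have ej : j (S x) = B (j x + K (j (S x))).
    by rewrite {1}e -(WB _ WxK).2 (blD jb) (WK _ WSx).2.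
  by rewrite {1}ej BA addrK.
have WS n : W (iter n S w) by elim: n => //= n; exact: SW.
by elim=> //= n ->; rewrite Sj.
Qed.

End CommutingSet.

(** * The set of compatible resolvents and its expansions *)

Variables (T : V -> V) (E : set V).
Hypothesis Tb : bounded_lin T.

Definition jshift (a b : R) (x : V) : V := jscale a b x - T x.

Definition compat_resolvent (a b : R) : Prop :=
  exists2 S, inverse_in_BR (jshift a b) S & E `<=` commuting_set S.

(** Here T perturbs multiplication by a + b j, whose inverse is multiplication by the conjugate
    divided by the squared modulus. *)
Lemma compat_resolvent_large (c a b : R) :
  (forall x, `|T x| <= c * `|x|) -> 0 <= c -> c < Num.sqrt (a ^+ 2 + b ^+ 2) ->
  E `<=` commuting_set T -> compat_resolvent a b.
Proof.
move=> hT c0 cs ET; set n2 := a ^+ 2 + b ^+ 2 in cs.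
have s0 : 0 < Num.sqrt n2 by exact: le_lt_trans cs.
have n20 : n2 != 0 by rewrite gt_eqF // -sqrtr_gt0.
have e1 : a * (a / n2) - b * (- b / n2) = 1.
  by rewrite -(divff n20) {3}/n2 !mulrA -mulrBl mulrN opprK -!expr2.
have e2 : a * (- b / n2) + b * (a / n2) = 0.
  by rewrite !mulrA -mulrDl mulrN mulrC [a * b]mulrC addNr mulr0.
have inv1 x : jscale a b (jscale (a / n2) (- b / n2) x) = x.
  by rewrite jscaleM e1 e2 /jscale scale1r scale0r addr0.
have inv2 x : jscale (a / n2) (- b / n2) (jscale a b x) = x.
  by rewrite jscaleM -[RHS]inv1 jscaleM; congr jscale; rewrite mulrC (mulrC b) // addrC
    (mulrC _ b) (mulrC _ a).
have hinv x : `|jscale (a / n2) (- b / n2) x| <= (Num.sqrt n2)^-1 * `|x|.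
  by rewrite -{2}[x]inv1 (norm_jscale a b) mulrA mulVf ?mul1r // gt_eqF.
have [|||||S Sinv SW] := @perturbation_commuting T Tb (jscale a b) _ T _ c _ Tb _ c0 _ hinv hT.
- by split; [exact: jscale_bl|].
- by rewrite invr_ge0 ltW.
- by rewrite mulrC ltr_pdivrMr ?mul1r.
- move=> x Wx; split; first exact: commuting_set_jscale.
  by rewrite /jscale (blD jb) !(blZ jb).
- by move=> x Wx; split; [exact: commuting_set_op|exact: (Wx 1%N)].
by exists S => // x /ET; exact: SW.
Qed.

Lemma compat_resolvent_open a b : compat_resolvent a b ->
  exists2 d, 0 < d & forall x y, `|x - a| < d -> `|y - b| < d -> compat_resolvent x y.
Proof.
move=> [S Sinv ES]; case: (Sinv) => Sb _; have [C C0 hC] := bl_bound Sb.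
(* Two coordinates closer than this move the point by less than [1 / C], the smallness that the
   perturbation of [jshift a b] with inverse [S] requires. *)
exists (2 * C)^-1; first by rewrite invr_gt0 mulr_gt0.
move=> x y xa yb; set d := _^-1 in xa yb.
have d0 : 0 < d by rewrite invr_gt0 mulr_gt0.
set n := Num.sqrt ((a - x) ^+ 2 + (b - y) ^+ 2).
have nd : n < 2 * d.
  rewrite -[ltRHS]ger0_norm ?mulr_ge0 ?ltW // -sqrtr_sqr ltr_sqrt ?exprn_gt0 ?mulr_gt0 //.
  move: xa yb; rewrite !ltr_norml => /andP[? ?] /andP[? ?]; nra.
have [||||S' S'inv SW] := @perturbation_commuting S Sb (jshift a b) S
    (jscale (a - x) (b - y)) C n Sinv (jscale_bl _ _) (ltW C0) (sqrtr_ge0 _) _ hC.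
- have -> : 1 = C * (2 * d) by rewrite /d; field; rewrite gt_eqF.
  by rewrite ltr_pM2l.
- by move=> z; rewrite norm_jscale.
- by move=> z Wz; split; [exact: commuting_set_op|exact: (Wz 1%N)].
- move=> z Wz; split; first exact: commuting_set_jscale.
  by rewrite /jscale (blD jb) !(blZ jb).
exists S'; last by move=> v /ES; exact: SW.
have -> : jshift x y = fun z => jshift a b z - jscale (a - x) (b - y) z; last by [].
apply/funext => z; have -> : jshift a b z = jshift x y z + jscale (a - x) (b - y) z.
  rewrite /jshift [RHS]addrAC; congr (_ - _); rewrite /jscale addrACA -!scalerDl.
  by rewrite [x + _]addrC subrK [y + _]addrC subrK.
by rewrite addrK.
Qed.

(** Both orders are kept: the first is iterated in the Taylor expansion, the second bounds [S'] by
    [S]. *)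
Lemma resolvent_identity a b x y S S' z :
  inverse_in_BR (jshift a b) S -> inverse_in_BR (jshift (a + x) (b + y)) S' ->
  S' z = S z - S' (jscale x y (S z)) /\ S' z = S z - S (jscale x y (S' z)).
Proof.
move=> [Sb [SA AS]] [S'b [SA' AS']].
have e w : jshift (a + x) (b + y) w = jshift a b w + jscale x y w.
  by rewrite /jshift [RHS]addrAC; congr (_ - _); rewrite /jscale !scalerDl addrACA.
split; apply/esym.
  by have := SA' (S z); rewrite e AS (blD S'b) => h; apply/eqP; rewrite subr_eq h.
by have := SA (S' z); rewrite -[jshift a b _](addrK (jscale x y (S' z))) -e AS' (blB Sb).
Qed.

Lemma resolvent_local_bound a b x y S S' C :
  inverse_in_BR (jshift a b) S -> inverse_in_BR (jshift (a + x) (b + y)) S' ->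
  0 < C -> (forall z, `|S z| <= C * `|z|) ->
  C * Num.sqrt (x ^+ 2 + y ^+ 2) <= 2^-1 -> forall z, `|S' z| <= 2 * C * `|z|.
Proof.
move=> iS iS' C0 hC xy z; have [_ e] := resolvent_identity z iS iS'.
have : `|S' z| <= C * `|z| + C * Num.sqrt (x ^+ 2 + y ^+ 2) * `|S' z|.
  rewrite {1}e (le_trans (ler_normB _ _)) // lerD //.
  by rewrite (le_trans (hC _)) // norm_jscale mulrA.
have : C * Num.sqrt (x ^+ 2 + y ^+ 2) * `|S' z| <= 2^-1 * `|S' z| by rewrite ler_wpM2r.
by move: (C * Num.sqrt _ * _) => t; lra.
Qed.

(** Three applications of the resolvent identity. As powers of [S] commute with j on v, the
    increments collect into powers of x + y j, with one remainder under [S']. *)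
Lemma resolvent_expansion a b x y S S' v :
  inverse_in_BR (jshift a b) S -> inverse_in_BR (jshift (a + x) (b + y)) S' ->
  commuting_set S v ->
  S' v = S v - jscale x y (iter 2 S v) + jscale x y (jscale x y (iter 3 S v))
         - S' (jscale x y (jscale x y (jscale x y (iter 3 S v)))).
Proof.
move=> iS iS' Wv; have Sb := iS.1.
have W1 := commuting_set_jscale Sb x y Wv.
have c n w : commuting_set S w -> jscale x y (iter n S w) = iter n S (jscale x y w).
  by move=> Ww; rewrite iter_jscale.
have [e1 _] := resolvent_identity v iS iS'.
have [e2 _] := resolvent_identity (S (jscale x y v)) iS iS'.
have [e3 _] := resolvent_identity (S (S (jscale x y (jscale x y v)))) iS iS'.
rewrite (c 1%N _ Wv : _ = S _) in e1; rewrite (c 2 _ W1 : _ = S (S _)) in e2.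
rewrite (c 2 _ Wv) (c 3 _ Wv) (c 3 _ W1) e1 e2 e3 /= !opprB.
by rewrite [X in _ + X]addrC !addrA addrAC.
Qed.

(* If every point were in the resolvent set, [s |-> S_s v] would be entire and would
   vanish at infinity. *)
Lemma compat_resolvent_neqT v : E v -> v != 0 -> exists a b, ~ compat_resolvent a b.
Proof.
move=> Ev v0; apply: contrapT => noab.
have all_ab p : exists S, inverse_in_BR (jshift p.1 p.2) S /\ E `<=` commuting_set S.
  apply: contrapT => h; apply: noab; exists p.1, p.2 => -[S ? ?]; apply: h.
  by exists S.
pose S p := projT1 (cid (all_ab p)).
have SP p : inverse_in_BR (jshift p.1 p.2) (S p) /\ E `<=` commuting_set (S p).
  exact: projT2 (cid (all_ab p)).
have iS a b : inverse_in_BR (jshift a b) (S (a, b)) by case: (SP (a, b)).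
have WS a b : commuting_set (S (a, b)) v by case: (SP (a, b)) => _; exact.
pose F a b := S (a, b) v.
suff F00 : F 0 0 = 0.
  have [_ [_ AS]] := iS 0 0; move/eqP: v0; apply; rewrite -(AS v) -[S _ v]/(F 0 0) F00.
  by rewrite /jshift (bl0 (jscale_bl _ _)) (bl0 Tb) subrr.
have sq h : Num.sqrt (h ^+ 2 + 0 ^+ 2) = `|h| by rewrite expr0n addr0 sqrtr_sqr.
have sq' h : Num.sqrt (0 ^+ 2 + h ^+ 2) = `|h| by rewrite expr0n add0r sqrtr_sqr.
apply: four_point_liouville.
- move=> a b e e0; have Sb := (iS a b).1; have [C C0 hC] := bl_bound Sb.
  (* The difference will be at most [e * ((N - 1) / N)]; the summand 1 keeps [N] positive and the
     bound strict. The radius [(4 * C)^-1] below serves [resolvent_local_bound]. *)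
  pose N := 2 * C * `|F a b| * 2 + 1.
  have N0 : 0 < N by rewrite ltr_wpDl // !mulr_ge0 // ltW.
  exists (Num.min (e / N) (4 * C)^-1).
    by rewrite lt_min divr_gt0 //= invr_gt0 mulr_gt0.
  move=> x y; rewrite !lt_min => /andP[xe xC] /andP[ye yC].
  have n2 : Num.sqrt ((x - a) ^+ 2 + (y - b) ^+ 2) <= `|x - a| + `|y - b|.
    exact: sqrt_sqrD_le.
  have iS' := iS x y; have xE : x = a + (x - a) by rewrite addrC subrK.
  have yE : y = b + (y - b) by rewrite addrC subrK.
  rewrite {1}xE {1}yE in iS'.
  have [+ _] := resolvent_identity v (iS a b) iS'; rewrite /F => ->.
  rewrite addrC addKr normrN.
  have hS' := resolvent_local_bound (iS a b) iS' C0 hC.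
  apply: le_lt_trans (hS' _ _) _.
    have : C * (`|x - a| + `|y - b|) <= C * ((4 * C)^-1 + (4 * C)^-1).
      by rewrite ler_pM2l // lerD // ltW.
    have -> : C * ((4 * C)^-1 + (4 * C)^-1) = 2^-1 by field; rewrite gt_eqF.
    by apply: le_trans; rewrite ler_pM2l.
  rewrite norm_jscale -/(F a b).
  have : 2 * C * (Num.sqrt ((x - a) ^+ 2 + (y - b) ^+ 2) * `|F a b|) <=
    2 * C * (2 * (e / N) * `|F a b|).
    rewrite ler_pM2l ?mulr_gt0 // ler_wpM2r // (le_trans n2) //.
    by rewrite mulr_natl mulr2n lerD // ltW.
  move=> /le_lt_trans; apply.
  have -> : 2 * C * (2 * (e / N) * `|F a b|) = e * ((N - 1) / N).
    by rewrite /N; field; rewrite gt_eqF.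
  by rewrite gtr_pMr // ltr_pdivrMr // mul1r ltrBlDr ltrDl.
- move=> a b; have Sb := (iS a b).1; have [C C0 hC] := bl_bound Sb.
  set S3 := iter 3 (S (a, b)) v; set S2 := iter 2 (S (a, b)) v.
  exists (4 * (2 * C * `|S3|)), (2 * C)^-1; split; first by rewrite invr_gt0 mulr_gt0.
  move=> h h0 hd.
  pose r x y := S (a + x, b + y) (jscale x y (jscale x y (jscale x y S3))).
  have FE x y : F (a + x) (b + y) =
      F a b - jscale x y S2 + jscale x y (jscale x y S3) - r x y.
    exact: (resolvent_expansion (iS a b) (iS (a + x) (b + y)) (WS a b)).
  have Ch : C * h <= 2^-1.
    rewrite -ler_pdivlMl // -invfM mulrC ltW //.
  have rb x y : Num.sqrt (x ^+ 2 + y ^+ 2) = h -> `|r x y| <= 2 * C * `|S3| * h ^+ 3.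
    move=> xy; apply: le_trans
      (resolvent_local_bound (iS a b) (iS (a + x) (b + y)) C0 hC _ _) _; first by rewrite xy.
    by rewrite !norm_jscale xy !exprS expr0 mulr1 -!mulrA [X in _ <= _ * (_ * X)]mulrC
      -!mulrA.
  have hn : `|h| = h by rewrite ger0_norm // ltW.
  have r1 := rb h 0; have r2 := rb (- h) 0; have r3 := rb 0 h; have r4 := rb 0 (- h).
  rewrite sq hn in r1; rewrite sq normrN hn in r2.
  rewrite sq' hn in r3; rewrite sq' normrN hn in r4.
  (* The linear terms cancel in opposite pairs and the quadratic ones because 1 + 1 + j^2 + j^2 = 0,
     so only the four remainders survive. *)
  have -> : F (a + h) b + F (a - h) b + F a (b + h) + F a (b - h) - 4 *: F a b
     = - (r h 0 + r (- h) 0 + r 0 h + r 0 (- h)).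
    rewrite -{1 2}[b]addr0 -{3 4}[a]addr0 !FE !jscaleM /jscale.
    rewrite !(mul0r, mulr0, subr0, sub0r, addr0, add0r, scale0r, mulrN, mulNr, opprK, scaleNr).
    have pair (f s q t t' : V) :
        f - s + q - t + (f + s + q - t') = (f + f) + (q + q) - (t + t').
      by rewrite addrACA -opprD [X in X - _]addrACA [f - s + _]addrACA addNr addr0.
    have sum4 (f s t q t1 t2 t3 t4 : V) :
        f - s + q - t1 + (f + s + q - t2) + (f - t - q - t3) + (f + t - q - t4)
        - 4 *: f = - (t1 + t2 + t3 + t4).
      rewrite -(addrA _ (f - t - q - t3)) !pair addrACA -opprD.
      rewrite [f + f + _ + _]addrACA -opprD subrr addr0.
      have -> : 4 *: f = f + f + (f + f) by rewrite scaler_nat !mulrS mulr0n addr0 !addrA.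
      by rewrite [LHS]addrAC subrr sub0r !addrA.
    exact: sum4.
  rewrite normrN; apply: le_trans (_ : _ <= `|r h 0| + `|r (- h) 0| + `|r 0 h| + `|r 0 (- h)|) _.
    by do 3![apply: le_trans (ler_normD _ _) _; rewrite lerD2r].
  have := r1 erefl; have := r2 erefl; have := r3 erefl; have := r4 erefl; lra.
- move=> e e0; have [c c0 hc] := bl_bound Tb.
  (* Beyond this radius (1 + |v|/e) |F| <= |v|, so |F| >= e would give e + |v| <= |v|. *)
  exists (c + 1 + `|v| / e); first by rewrite ltr_wpDr // ?divr_ge0 // ?ltW // addr_gt0.
  move=> a b; set n := c + 1 + _ => nab.
  have n0 : 0 < n by rewrite ltr_wpDr // ?divr_ge0 // ?ltW // addr_gt0.
  have ns : n <= Num.sqrt (a ^+ 2 + b ^+ 2).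
    have -> : n = Num.sqrt (n ^+ 2) by rewrite sqrtr_sqr ger0_norm // ltW.
    exact: ler_wsqrtr.
  have [_ [_ /(_ v) AS]] := iS a b.
  have h1 : Num.sqrt (a ^+ 2 + b ^+ 2) * `|F a b| <= `|v| + c * `|F a b|.
    rewrite -norm_jscale -{1}AS -/(F a b) /jshift.
    apply: le_trans (_ : _ <= `|jscale a b (F a b) - T (F a b)| + `|T (F a b)|) _.
      by rewrite -{1}(subrK (T (F a b)) (jscale a b (F a b))) ler_normD.
    by rewrite lerD2l.
  have h2 : n * `|F a b| <= Num.sqrt (a ^+ 2 + b ^+ 2) * `|F a b| by rewrite ler_wpM2r.
  have h3 : (1 + `|v| / e) * `|F a b| <= `|v| by move: h1 h2; rewrite /n; lra.
  rewrite ltNge; apply/negP => eF.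
  have : (1 + `|v| / e) * e <= `|v|.
    by apply: le_trans h3; rewrite ler_wpM2l // addr_ge0 // divr_ge0 // ltW.
  rewrite mulrDl mul1r divfK ?gt_eqF // => h4; lra.
Qed.

End ComplexStructure.

(** * The pull-back spectrum *)

Section PullBackSpectrum.
Variables (R : realType) (V : completeNormedModType R).
Variables (lm : Oct R -> V -> V) (rm : V -> Oct R -> V).
Hypothesis HV : BanachOBimodule lm rm.
Variables (T : V -> V) (J : Oct R).
Hypothesis Tb : bounded_lin T.
Hypothesis JS : oS R J.

Local Notation j := (rm^~ J).
Local Notation point a b := (a *: oone R + b *: J).
Local Notation E := [set v | Defs.ReM lm rm v].

Lemma rm_bl : bounded_lin j.
Proof.
split; first by move=> a x y; rewrite (rm_linl HV).
by exists (onorm J) => x; rewrite (norm_rm HV).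
Qed.

Lemma rm_sqr x : rm (rm x J) J = - x.
Proof.
have := assoc1_diag HV J x; rewrite (assoc_12 HV) (assoc_23 HV) /assoc3 JS.
by rewrite -(scaleN1r (oone R)) (rmZr HV) (rm_one HV) scaleN1r => /eqP; rewrite subr_eq0 => /eqP.
Qed.

Lemma rm_point a b x : rm x (point a b) = jscale j a b x.
Proof. by rewrite (rmDr HV) !(rmZr HV) (rm_one HV). Qed.

Lemma norm_rm_point a b x : `|jscale j a b x| = Num.sqrt (a ^+ 2 + b ^+ 2) * `|x|.
Proof. by rewrite -rm_point (norm_rm HV) onorm_CJ. Qed.

Lemma RsT_jshift a b : RsT rm (point a b) T = jshift j T a b.
Proof. by apply/funext => x; rewrite /RsT rm_point. Qed.

Lemma jshift_bl a b : bounded_lin (jshift j T a b).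
Proof. by apply: bl_sub => //; apply: jscale_bl; [exact: rm_bl|exact: norm_rm_point]. Qed.

(** By linearity commuting with all of C_J amounts to commuting with J; the power n = 0, present
    only in [commuting_set], is trivial. *)
Lemma CJ_ext_paP S : bounded_lin S -> CJ_ext_pa lm rm J S <-> E `<=` commuting_set j S.
Proof.
move=> Sb; split=> [h v Ev [//|n]|h n v l _ Ev [a [b ->]]].
  by apply: h => //; exists 0, 1; rewrite scale0r add0r scale1r.
by rewrite !rm_point; apply: iter_jscale => //; exact: h.
Qed.

Lemma rhoJP a b : rhoJ lm rm T J (point a b) <-> compat_resolvent j T E a b.
Proof.
rewrite /rhoJ /= RsT_jshift; split=> [[_ [_ [S [Sinv /CJ_ext_paP ES]]]]|[S Sinv ES]].
  by exists S => //; apply: ES; case: Sinv.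
split; first by exists a, b.
split; first exact: jshift_bl.
by exists S; split => //; apply/CJ_ext_paP => //; case: Sinv.
Qed.

Hypothesis Tpa : power_assoc lm rm T.

Lemma rhoJ_large s : CJ J s -> opnorm T < onorm s -> rhoJ lm rm T J s.
Proof.
move=> [a [b ->]]; rewrite onorm_CJ // => Tab; apply/rhoJP.
have [T0 hT] := opnorm_ge0_bound Tb.
apply: (compat_resolvent_large rm_bl rm_sqr norm_rm_point Tb hT T0 Tab) => v Ev n.
exact: (B_RO_rm_ReM HV J (Tpa n) Ev).
Qed.

Lemma sigmaJ_nonempty : (exists v : V, v != 0) -> sigmaJ lm rm T J !=set0.
Proof.
move=> /(ReM_neq0 HV)[v Ev v0].
have [a [b ab]] := compat_resolvent_neqT rm_bl rm_sqr norm_rm_point Tb Ev v0.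
exists (point a b); split; first by exists a, b.
by move=> /rhoJP.
Qed.

(** The set is the image of a planar set under (a, b) -> a + bJ. That planar set is closed because
    compatible resolvents form an open set, and [rhoJ_large] bounds it by the norm of T. *)
Lemma sigmaJ_compact : compact (sigmaJ lm rm T J).
Proof.
pose K : set (R * R) := ~` [set p | compat_resolvent j T E p.1 p.2].
pose phi (p : R * R) : Oct R := point p.1 p.2.
have -> : sigmaJ lm rm T J = phi @` K.
  apply/seteqP; split=> [_ [[a [b ->]] nab]|_ [[a b] nab <-]].
    by exists (a, b) => // /rhoJP.
  by split; [exists a, b|move=> /rhoJP].
apply: continuous_compact.
  apply: continuous_subspaceT => -[a b]; apply: cvgD.
    by apply: cvgZ; [exact: cvg_fst|exact: cvg_cst].
  by apply: cvgZ; [exact: cvg_snd|exact: cvg_cst].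
set M := opnorm T.
apply: (@subclosed_compact _ _ (`[- M, M] `*` `[- M, M])).
- apply: open_closedC; rewrite openE => -[a b] /=.
  move=> /(compat_resolvent_open rm_bl rm_sqr norm_rm_point)[d d0 h].
  exists (ball a d, ball b d); first by split; exact: nbhsx_ballx.
  by move=> [x y] [/= xa yb]; apply: h; rewrite distrC.
- by apply: compact_setX; exact: segment_compact.
move=> [a b] nab; have ab : Num.sqrt (a ^+ 2 + b ^+ 2) <= M.
  rewrite leNgt; apply/negP => Mab; apply: nab; apply/rhoJP/rhoJ_large.
    by exists a, b.
  by rewrite onorm_CJ.
have [aM bM] : `|a| <= M /\ `|b| <= M.
  rewrite -!sqrtr_sqr; split; apply: le_trans ab; apply: ler_wsqrtr.
    by rewrite lerDl sqr_ge0.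
  by rewrite lerDr sqr_ge0.
by split; rewrite /= in_itv /= -ler_norml.
Qed.

End PullBackSpectrum.

Theorem mainTheorem10 (R : realType) (V : completeNormedModType R)
  (lm : Oct R -> V -> V) (rm : V -> Oct R -> V)
  (HV : BanachOBimodule lm rm) (Vnz : exists v : V, v != 0)
  (T : V -> V) (HT : B_RO lm rm T) (Hpa : power_assoc lm rm T) :
  (forall s : Oct R, opnorm T < onorm s ->
     rho lm rm T s /\ (forall J, oS R J -> CJ J s -> rhoJ lm rm T J s)) /\
  (forall J, oS R J -> sigmaJ lm rm T J !=set0 /\ compact (sigmaJ lm rm T J)).
Proof.
have [Tb _] := HT; split=> [s Ts|J JS].
  have large J : oS R J -> CJ J s -> rhoJ lm rm T J s.
    by move=> JS sJ; exact: rhoJ_large.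
  split=> //; have [J [JS sJ]] := mem_some_CJ s.
  by exists J; split => //; exact: large.
by split; [exact: sigmaJ_nonempty|exact: sigmaJ_compact].
Qed.
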